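(* Let $n\ge 1$ be an integer. If $\mu$ is any locally optimal outer measure on $\mathbb{R}^n$, then for all $x\in\mathbb{R}^n$, \[\dim_{\mathrm{loc}}\mu(x)=\dim(x)\qquad\text{and}\qquad \mathrm{Dim}_{\mathrm{loc}}\mu(x)=\mathrm{Dim}(x).\]
   Context: Here $\mathbb{N}=\{0,1,2,\ldots\}$ and all logarithms are base 2. Outer measures. An outer measure on $\mathbb{R}^n$ is a function $\mu:\mathcal{P}(\mathbb{R}^n)\to[0,\infty]$ with $\mu(\emptyset)=0$ that is monotone and countably subadditive. It is *supported on $\mathbb{Q}^n$* if $\mu(\mathbb{R}^n\setminus\mathbb{Q}^n)=0$. It is *finitely supported on $\mathbb{Q}^n$* if for every $\varepsilon>0$ there is a finite set $A\subseteq\mathbb{Q}^n$ with $\mu(\mathbb{R}^n\setminus A)<\varepsilon$. It is *strongly finite* if it is supported on $\mathbb{Q}^n$ and $\sum_{q\in\mathbb{Q}^n}\mu(\{q\})<\infty$. It is *lower semicomputable* if it is finitely supported on $\mathbb{Q}^n$ and there is a computable function $\hat\mu:\mathcal{P}^{<\omega}(\mathbb{Q}^n)\times\mathbb{N}\to\mathbb{Q}\cap[0,\infty)$ (where $\mathcal{P}^{<\omega}(\mathbb{Q}^n)$ is the set of all finite subsets of $\mathbb{Q}^n$) such that for all finite $A\subseteq\mathbb{Q}^n$: (i) $\hat\mu(A,s)\le\hat\mu(A,t)\le\mu(A)$ whenever $s\le t$; (ii) $\lim_{t\to\infty}\hat\mu(A,t)=\mu(A)$. Dyadic cubes. For $m=(m_1,\ldots,m_n)\in\mathbb{Z}^n$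 and $r\in\mathbb{N}$, the $r$-dyadic cube with address $m$ is $Q_m^{(r)}=\{2^{-r}x\mid x\in[m_1,m_1+1)\times\cdots\times[m_n,m_n+1)\}$, and $\mathcal{Q}^{(r)}=\{Q_m^{(r)}\mid m\in\mathbb{Z}^n\}$. Local optimality. For outer measures $\mu,\nu$ on $\mathbb{R}^n$, $\mu$ *dominates $\nu$ on dyadic cubes* if there is a function $\beta:\mathbb{N}\to(0,\infty)$ with $\beta(r)=2^{-o(r)}$ as $r\to\infty$ such that $\mu(E)\ge\beta(r)\nu(E)$ for every $r\in\mathbb{N}$ and every $E\in\mathcal{Q}^{(r)}$. An outer measure $\mu$ on $\mathbb{R}^n$ is *locally optimal* if (i) $\mu$ is strongly finite and lower semicomputable, and (ii) $\mu$ dominates every strongly finite, lower semicomputable outer measure $\nu$ on $\mathbb{R}^n$ on dyadic cubes. Local dimensions. For a locally finite outer measure $\mu$ on $\mathbb{R}^n$ (every point has an open neighborhood of finite $\mu$-value) and $x\in\mathbb{R}^n$, \[\dim_{\mathrm{loc}}\mu(x)=\liminf_{r\to\infty}\frac{\log\frac1{\mu(B(x,2^{-r}))}}{r},\qquad \mathrm{Dim}_{\mathrm{loc}}\mu(x)=\limsup_{r\to\infty}\frac{\log\frac1{\mu(B(x,2^{-r}))}}{r},\] where $B(x,\varepsilon)$ is the open Euclidean ball of radius $\varepsilon$ about $x$ and $r$ ranges over $\mathbb{N}$. Algorithmic dimensions. Fix a universal prefix Turing machine $U$ (the domain of a prefix machine is a prefix-free set of binary strings; universality gives, for each prefix machine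 $M$, a constant $c_M$ such that whenever $M(\pi)=w$ there is $\pi'$ with $U(\pi')=w$ and $|\pi'|\le|\pi|+c_M$). The prefix Kolmogorov complexity is $\mathrm{K}(w)=\min\{|\pi|\mid U(\pi)=w\}$, extended from binary strings to countable domains such as $\mathbb{Q}^n$ and $\mathbb{N}$ by fixed standard binary encodings. For $x\in\mathbb{R}^n$ and $r\in\mathbb{N}$, $\mathrm{K}_r(x)=\min\{\mathrm{K}(q)\mid q\in\mathbb{Q}^n,\ |q-x|<2^{-r}\}$. Then $\dim(x)=\liminf_{r\to\infty}\mathrm{K}_r(x)/r$ and $\mathrm{Dim}(x)=\limsup_{r\to\infty}\mathrm{K}_r(x)/r$. *)

(* Defs.v *)
From HB Require Import structures.
From mathcomp Require Import all_boot all_order all_algebra finmap.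
From mathcomp Require Import all_classical all_reals all_analysis.

Set Implicit Arguments.
Unset Strict Implicit.
Unset Printing Implicit Defensive.

Import Order.TTheory GRing.Theory Num.Theory.
Import numFieldNormedType.Exports.

Local Open Scope classical_set_scope.
Local Open Scope ring_scope.

(** * Turing machines *)

(* Deterministic machines with finitely many two-way infinite tapes over the
   alphabet {0, 1, blank}; [None] is the blank. *)
Definition symbol := option bool.

Inductive direction := Left | Stay | Right.

(* The tape whose cells strictly to the left of the head are [before], nearest
   first, and strictly to the right are [after]; all other cells are blank. *)
Record tape := Tape {
  before : seq symbol;
  scanned : symbol;
  after : seq symbol }.

Definition write_head (a : symbol) (t : tape) := Tape (before t) a (after t).

Definition move_head (d : direction) (t : tape) :=
  match d with
  | Left => if before t is a :: l then Tape l a (scanned t :: after t)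
            else Tape [::] None (scanned t :: after t)
  | Stay => t
  | Right => if after t is a :: l then Tape (scanned t :: before t) a l
             else Tape (scanned t :: before t) None [::]
  end.

(* The machine has [work_tapes.+1] tapes; tape 0 carries the input and the
   output. A transition equal to [None] halts the machine. *)
Record machine := Machine {
  state : finType;
  work_tapes : nat;
  initial : state;
  transition : state -> {ffun 'I_work_tapes.+1 -> symbol} ->
    option (state * {ffun 'I_work_tapes.+1 -> symbol * direction}) }.

Definition config (M : machine) : Type :=
  (state M * {ffun 'I_(work_tapes M).+1 -> tape})%type.

Definition blank_tape := Tape [::] None [::].

Definition input_tape (w : seq bool) :=
  if w is b :: w' then Tape [::] (Some b) (map Some w') else blank_tape.

Definition start (M : machine) (w : seq bool) : config M :=
  (initial M, [ffun i => if i == ord0 then input_tape w else blank_tape]).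

Definition step (M : machine) (c : config M) : option (config M) :=
  if transition c.1 [ffun i => scanned (c.2 i)] is Some (q, act) then
    Some (q, [ffun i => move_head (act i).2 (write_head (act i).1 (c.2 i))])
  else None.

Fixpoint leading_bits (s : seq symbol) : seq bool :=
  if s is Some b :: s' then b :: leading_bits s' else [::].

(* The output is read on tape 0 from the head rightwards up to the first
   blank. *)
Definition output (M : machine) (c : config M) : seq bool :=
  leading_bits (scanned (c.2 ord0) :: after (c.2 ord0)).

Definition computes (M : machine) (w v : seq bool) : Prop :=
  exists (t : nat) (c : config M),
    [/\ iter t (obind (@step M)) (Some (start M w)) = Some c,
        step c = None & output c = v].

Definition halts_on (M : machine) : set (seq bool) :=
  [set w | exists v, computes M w v].

Definition prefix_free (A : set (seq bool)) : Prop :=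
  forall v w, A v -> A w -> prefix v w -> v = w.

Definition prefix_machine (M : machine) : Prop := prefix_free (halts_on M).

Definition universal_prefix_machine (U : machine) : Prop :=
  prefix_machine U /\
  forall M, prefix_machine M ->
    exists c : nat, forall p w, computes M p w ->
      exists2 p', computes U p' w & (size p' <= size p + c)%N.

(** * Binary encodings *)

(* Binary digits, least significant first. *)
Definition bits (k : nat) : seq bool :=
  mkseq (fun i => odd (k %/ 2 ^ i)%N) (trunc_log 2 k).+1.

(* Every bit is doubled and 01 marks the end, so that all the encodings below
   are self-delimiting. *)
Definition nat_code (k : nat) : seq bool :=
  flatten [seq [:: b; b] | b <- bits k] ++ [:: false; true].

Definition int_code (z : int) : seq bool := (z < 0) :: nat_code `|z|%N.

Definition rat_code (q : rat) : seq bool :=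
  int_code (numq q) ++ int_code (denq q).

Definition vec_code (n : nat) (q : 'rV[rat]_n) : seq bool :=
  flatten [seq rat_code (q 0 i) | i <- enum 'I_n].

Definition list_code (n : nat) (s : seq 'rV[rat]_n) : seq bool :=
  nat_code (size s) ++ flatten [seq vec_code q | q <- s].

(* A finite subset of Q^n is presented to the machine as any list of its
   elements; the value must not depend on the list. *)
Definition computable_set_function (n : nat)
    (f : {fset 'rV[rat]_n} -> nat -> rat) : Prop :=
  exists M : machine, forall (s : seq 'rV[rat]_n) (t : nat),
    computes M (list_code s ++ nat_code t) (rat_code (f [fset q in s]%fset t)).

(** * Kolmogorov complexity and algorithmic dimensions *)

(* The least element of a set of natural numbers; 0 if the set is empty. *)
Definition min_nat (A : set nat) : nat :=
  if pselect (exists k, `[< A k >]) is left exA then ex_minn exA else 0%N.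

Definition complexity (U : machine) (w : seq bool) : nat :=
  min_nat [set size p | p in [set p | computes U p w]].

Definition rat_complexity (U : machine) (n : nat) (q : 'rV[rat]_n) : nat :=
  complexity U (vec_code q).

(* The norm that the library puts on row vectors is the sup norm. *)
Definition euclidean_norm (R : realType) (n : nat) (v : 'rV[R]_n) : R :=
  Num.sqrt (\sum_(i < n) v 0 i ^+ 2).

Definition euclidean_ball (R : realType) (n : nat) (x : 'rV[R]_n) (e : R) :
    set 'rV[R]_n :=
  [set y | euclidean_norm (y - x) < e].

Definition rat_point (R : realType) (n : nat) (q : 'rV[rat]_n) : 'rV[R]_n :=
  map_mx ratr q.

Definition complexity_at (U : machine) (R : realType) (n : nat)
    (x : 'rV[R]_n) (r : nat) : nat :=
  min_nat [set rat_complexity U q | q in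
    [set q : 'rV[rat]_n | euclidean_norm (rat_point R q - x) < 2 ^- r]].

Definition alg_dim (U : machine) (R : realType) (n : nat) (x : 'rV[R]_n) : \bar R :=
  limn_einf (fun r => ((complexity_at U x r)%:R / r%:R)%:E).

Definition alg_Dim (U : machine) (R : realType) (n : nat) (x : 'rV[R]_n) : \bar R :=
  limn_esup (fun r => ((complexity_at U x r)%:R / r%:R)%:E).

(** * Outer measures on R^n *)

Section OuterMeasures.
Variables (R : realType) (n : nat).
Implicit Types mu nu : {outer_measure set 'rV[R]_n -> \bar R}.

Definition rat_points (A : set 'rV[rat]_n) : set 'rV[R]_n := @rat_point R n @` A.

Definition rat_supported mu : Prop := (mu (~` rat_points setT) = 0)%E.

Definition finitely_rat_supported mu : Prop :=
  forall e : R, 0 < e ->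
    exists A : {fset 'rV[rat]_n}, (mu (~` rat_points [set` A]) < e%:E)%E.

Definition strongly_finite mu : Prop :=
  rat_supported mu /\
  (\esum_(q in [set: 'rV[rat]_n]) mu [set rat_point R q] < +oo)%E.

Definition lower_semicomputable mu : Prop :=
  finitely_rat_supported mu /\
  exists muhat : {fset 'rV[rat]_n} -> nat -> rat,
    [/\ computable_set_function muhat,
        forall A t, 0 <= muhat A t,
        forall A s t, (s <= t)%N -> muhat A s <= muhat A t /\
          ((ratr (muhat A t))%:E <= mu (rat_points [set` A]))%E
      & forall A, (fun t => (ratr (muhat A t))%:E) @ \oo -->
          mu (rat_points [set` A])].

Definition dyadic_cube (r : nat) (m : 'rV[int]_n) : set 'rV[R]_n :=
  [set 2 ^- r *: x | x in
    [set x : 'rV[R]_n | forall i, (m 0 i)%:~R <= x 0 i < (m 0 i)%:~R + 1]].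

Definition dominates_on_dyadic_cubes mu nu : Prop :=
  exists beta : nat -> R,
    [/\ forall r, 0 < beta r,
        exists2 e : nat -> R,
          e =o_\oo (fun r => r%:R : R) & forall r, beta r = 2 `^ (- e r)
      & forall r m, ((beta r)%:E * nu (dyadic_cube r m) <=
                     mu (dyadic_cube r m))%E].

Definition locally_optimal mu : Prop :=
  [/\ strongly_finite mu, lower_semicomputable mu
    & forall nu, strongly_finite nu -> lower_semicomputable nu ->
        dominates_on_dyadic_cubes mu nu].

Definition log2 (x : \bar R) : \bar R := (lne x / (ln 2)%:E)%E.

(* The inverse of the extended real 0 is +oo, and log2 +oo = +oo. The formula
   is total; a strongly finite outer measure is finite, hence locally finite. *)
Definition local_rate mu (x : 'rV[R]_n) (r : nat) : \bar R :=
  (log2 (mu (euclidean_ball x (2 ^- r)))^-1 / r%:R%:E)%E.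

Definition dim_loc mu (x : 'rV[R]_n) : \bar R := limn_einf (local_rate mu x).

Definition Dim_loc mu (x : 'rV[R]_n) : \bar R := limn_esup (local_rate mu x).

End OuterMeasures.

(* Main.v *)
(* For E a set of points let nu(E) be the supremum of 2^-K(q) over the rational
   points q of E. This outer measure is strongly finite by Kraft's inequality,
   and lower semicomputable by running all programs; being a supremum, and not
   a sum, it is approximated by powers of 1/2. Since mu dominates nu on the cube
   of side 2^-(r+c) around a point q that realises K_(r+c)(x), and this cube lies
   in B(x, 2^-r), we get mu(B(x, 2^-r)) >= 2^-(K_(r+c)(x) + o(r)).

   Conversely, a cube of measure greater than 2^-k contains a finite set of
   rational points of measure greater than 2^-k, these sets are disjoint for
   distinct cubes of side 2^-r, and the measures of the points are summable. So
   there are O(2^k) such cubes, a machine can enumerate them, and one of them is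
   determined by r, k and a string of k + O(1) bits. As 3^n cubes cover
   B(x, 2^-r), this gives K_(r-c)(x) <= k + O(log k + log r) for k about
   log(1/mu(B(x, 2^-r))).

   The machines come from one construction: functions closed under primitive
   recursion on codes are computed by programs for counters, which are heads
   moving on marked tapes, and every machine needed is one unbounded search for
   the first value of such a function. *)
Require Import Defs.
From HB Require Import structures.
From mathcomp Require Import all_boot all_order all_algebra finmap.
From mathcomp Require Import all_classical all_reals all_analysis.
From mathcomp Require Import zify ring lra.

Set Implicit Arguments.
Unset Strict Implicit.
Unset Printing Implicit Defensive.

Import Order.TTheory GRing.Theory Num.Theory.
Import numFieldNormedType.Exports.

(** * Composing machines *)

(** The obstacle on the machine side is that universality applies to prefix machines only, so the
    domain of each machine has to be known exactly and divergence proved along with halting. Hence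
    [search_machine] is an equivalence, and prefix-freeness becomes a property of the function
    searched. That function is total: the running time of a simulated machine is one of its
    arguments, and testing candidates against the input replaces parsing. Counting cubes cannot rest
    on additivity: an outer measure is only subadditive, and disjoint cubes may all have large
    measure. What is additive is the sum over singletons. It bounds the measure of a finite set, and
    finite support leads from a cube to a finite set. The inequality with 2^-k is strict so that it
    shows at a finite stage of the approximation from below. The two rates are compared up to a
    factor 1 + e, a term e * r and a shift of r. The factor is what controls log k, as k is itself
    close to the rate. *)

Lemma iter_obindN A (f : A -> option A) k : iter k (obind f) None = None.
Proof. by elim: k => //= k ->. Qed.

Section Components.
Variable W : nat.

Definition tapes := {ffun 'I_W.+1 -> tape}.
Definition symbols := {ffun 'I_W.+1 -> symbol}.
Definition actions := {ffun 'I_W.+1 -> symbol * direction}.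

(** The number of work tapes is fixed for the section and not a field as in [machine], so that
    components acting on the same tapes can be composed. *)
Record component := Component {
  cstate : finType;
  cinit : cstate;
  ctrans : cstate -> symbols -> option (cstate * actions) }.

Definition to_machine (C : component) : machine :=
  @Machine (cstate C) W (cinit C) (@ctrans C).

Definition scan (T : tapes) : symbols := [ffun i => scanned (T i)].

Definition act (a : actions) (T : tapes) : tapes :=
  [ffun i => move_head (a i).2 (write_head (a i).1 (T i))].

Definition cstep (C : component) (c : cstate C * tapes) :=
  if ctrans c.1 (scan c.2) is Some (q, a) then Some (q, act a c.2) else None.

Definition run (C : component) t (c c' : cstate C * tapes) :=
  iter t (obind (@cstep C)) (Some c) = Some c'.

Definition halts (C : component) (T T' : tapes) :=
  exists t q, run t (cinit C, T) (q, T') /\ ctrans q (scan T') = None.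

(** Prefix-freeness concerns the inputs on which a machine halts, so absence of halting has to be
    provable. *)
Definition diverges (C : component) (T : tapes) :=
  forall t, exists c, run t (cinit C, T) c.

Lemma run_trans C t u (c c' c'' : cstate C * tapes) :
  run t c c' -> run u c' c'' -> run (u + t) c c''.
Proof. by rewrite /run iterD => ->. Qed.

Lemma run1 C (c c' : cstate C * tapes) : cstep c = Some c' -> run 1 c c'.
Proof. by []. Qed.

Lemma run_le C t u (c c' : cstate C * tapes) :
  (t <= u)%N -> run u c c' -> exists c'', run t c c''.
Proof.
move=> tu; rewrite /run -(subnK tu) iterD.
by case: (iter t _ _) => [c''|]; [exists c''|rewrite iter_obindN].
Qed.

Lemma run_sim C1 C2 (f : cstate C1 * tapes -> cstate C2 * tapes) t c c' :
  (forall c c', cstep c = Some c' -> cstep (f c) = Some (f c')) ->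
  run t c c' -> run t (f c) (f c').
Proof.
move=> sim; elim: t c' => [|t IH] c'; rewrite /run; first by case=> ->.
rewrite !iterS; case E: (iter t _ _) => [c1|] //= c1c'.
by rewrite [X in obind _ X](IH c1 E); exact: sim.
Qed.

Definition stay (s : symbols) : actions := [ffun i => (s i, Stay)].

Lemma act_stay T : act (stay (scan T)) T = T.
Proof. by apply/ffunP => i; rewrite !ffunE /=; case: (T i). Qed.

Definition prim (f : symbols -> actions) : component :=
  @Component bool true (fun q s => if q then Some (false, f s) else None).

Lemma halts_prim f T : halts (prim f) T (act (f (scan T)) T).
Proof. by exists 1%N, false. Qed.

Section Seq.
Variables C1 C2 : component.

(** When [C1] halts, one step that leaves the tapes unchanged hands over to [C2]. *)
Definition seq_trans (q : cstate C1 + cstate C2) (s : symbols) :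
    option ((cstate C1 + cstate C2) * actions) :=
  match q with
  | inl q => if ctrans q s is Some (q', a) then Some (inl q', a)
             else Some (inr (cinit C2), stay s)
  | inr q => if ctrans q s is Some (q', a) then Some (inr q', a) else None
  end.

Definition cseq : component := @Component _ (inl (cinit C1)) seq_trans.

Lemma run_seql t q T q' T' : run (C := C1) t (q, T) (q', T') ->
  run (C := cseq) t (inl q, T) (inl q', T').
Proof.
apply: (run_sim (C2 := cseq) (f := fun c => (inl c.1, c.2))).
by move=> [q1 T1] c'; rewrite /cstep /=; case: ctrans => // -[q2 a] [<-].
Qed.

Lemma run_seqr t q T q' T' : run (C := C2) t (q, T) (q', T') ->
  run (C := cseq) t (inr q, T) (inr q', T').
Proof.
apply: (run_sim (C2 := cseq) (f := fun c => (inr c.1, c.2))).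
by move=> [q1 T1] c'; rewrite /cstep /=; case: ctrans => // -[q2 a] [<-].
Qed.

Lemma run_seq_switch t q T T' : run t (cinit C1, T) (q, T') ->
  ctrans q (scan T') = None ->
  run (C := cseq) t.+1 (inl (cinit C1), T) (inr (cinit C2), T').
Proof.
move=> /run_seql /[swap] qN /run_trans; rewrite -add1n; apply.
by apply: run1; rewrite /cstep /= qN act_stay.
Qed.

Lemma halts_seq T T' T'' : halts C1 T T' -> halts C2 T' T'' -> halts cseq T T''.
Proof.
move=> [t [q [/run_seq_switch switch /switch{switch} r1]]] [u [q' [/run_seqr r2 q'N]]].
exists (u + t.+1)%N, (inr q'); split; first exact: run_trans r1 r2.
by rewrite /= q'N.
Qed.

Lemma diverges_seq T T' : halts C1 T T' -> diverges C2 T' -> diverges cseq T.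
Proof.
move=> [t [q [/run_seq_switch switch /switch{switch} r1]]] div u.
have [[q' T2] /run_seqr r2] := div u.
exact: run_le (leq_addr _ _) (run_trans r1 r2).
Qed.

Lemma diverges_seql T : diverges C1 T -> diverges cseq T.
Proof. by move=> div t; have [[q T'] /run_seql r] := div t; exists (inl q, T'). Qed.

End Seq.

Section While.
Variables (P : symbols -> bool) (C : component).

(** [None] is the head of the loop, where [P] is tested; entering and leaving the body cost one step
    each and do not touch the tapes. *)
Definition while_trans (q : option (cstate C)) (s : symbols) :
    option (option (cstate C) * actions) :=
  match q with
  | None => if P s then Some (Some (cinit C), stay s) else None
  | Some q => if ctrans q s is Some (q', a) then Some (Some q', a)
              else Some (None, stay s)
  end.

Definition cwhile : component := @Component _ None while_trans.

Lemma halts_while_false T : ~~ P (scan T) -> halts cwhile T T.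
Proof. by move=> /negbTE PT; exists 0%N, None; rewrite /= PT. Qed.

(** Since a round takes at least one step, [diverges_while] obtains arbitrarily long runs. *)
Lemma run_while T T' : P (scan T) -> halts C T T' ->
  exists t, run (C := cwhile) t.+1 (None, T) (None, T').
Proof.
move=> PT [t [q [r qN]]]; exists t.+1.
have r0 : run (C := cwhile) 1 (None, T) (Some (cinit C), T).
  by apply: run1; rewrite /cstep /= PT act_stay.
have r1 : run (C := cwhile) t (Some (cinit C), T) (Some q, T').
  apply: (run_sim (C2 := cwhile) (f := fun c => (Some c.1, c.2)) _ r).
  by move=> [q1 T1] c'; rewrite /cstep /=; case: ctrans => // -[q2 a] [<-].
have r2 : run (C := cwhile) 1 (Some q, T') (None, T').
  by apply: run1; rewrite /cstep /= qN act_stay.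
by have := run_trans (run_trans r0 r1) r2; rewrite addn1 add1n.
Qed.

Lemma halts_while_true T T' T'' : P (scan T) -> halts C T T' ->
  halts cwhile T' T'' -> halts cwhile T T''.
Proof.
move=> PT /(run_while PT) [t r1] [u [q [r2 qN]]].
by exists (u + t.+1)%N, q; split=> //; exact: run_trans r1 r2.
Qed.

Lemma diverges_while (I : nat -> tapes -> Prop) T :
  (forall k T, I k T -> P (scan T) /\ exists2 T', halts C T T' & I k.+1 T') ->
  I 0%N T -> diverges cwhile T.
Proof.
move=> HI I0 t; suff [u tu [T' r _]] : exists2 u, (t <= u)%N &
    exists2 T', run (C := cwhile) u (None, T) (None, T') & I t T' by exact: run_le r.
elim: t => [|t [u tu [T1 r I1]]]; first by exists 0%N => //; exists T.
have [/run_while PT [T2 /PT[v r'] I2]] := HI t T1 I1.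
exists (v.+1 + u)%N; first by rewrite addSn ltnS (leq_trans tu) ?leq_addl.
by exists T2 => //; exact: run_trans r r'.
Qed.

End While.

Lemma halts_computes (C : component) w T :
  halts C (start (to_machine C) w).2 T ->
  computes (to_machine C) w (leading_bits (scanned (T ord0) :: after (T ord0))).
Proof.
by move=> [t [q [r qN]]]; exists t, (q, T); split=> //; rewrite /step /= qN.
Qed.

Lemma diverges_computes (C : component) w v :
  diverges C (start (to_machine C) w).2 -> ~ computes (to_machine C) w v.
Proof.
move=> div [t [c [r cN _]]]; have [c'] := div t.+1.
have {}r : run (C := C) t (start (to_machine C) w) c := r.
by rewrite /run iterS [X in obind _ X]r /=; move: cN; rewrite /step /cstep /=;
  case: ctrans => [[]|].
Qed.

End Components.

Lemma computes_inj M w v v' : computes M w v -> computes M w v' -> v = v'.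
Proof.
move=> [t [c [rt ct <-]]] [u [d [ru du <-]]].
wlog tu : t u c d rt ct ru du / (t <= u)%N => [hwlog|].
  by have /orP[] := leq_total t u => /hwlog h; [|symmetry]; apply: h.
move: ru; rewrite -(subnK tu) iterD rt; case: (u - t)%N => [[->]//|k].
by rewrite iterSr /= ct iter_obindN.
Qed.

(** * Counter programs *)

(* A counter is stored as the distance of a head from a marked cell of an
   otherwise blank tape. *)
Definition counter (v : nat) (t : tape) : Prop :=
  scanned t :: before t = rcons (nseq v None) (Some true) /\
  exists j, after t = nseq j None.

Lemma counter0E v t : counter v t -> (scanned t == Some true) = (v == 0%N).
Proof. by case: t => b s a; case: v => [|v] [[-> _]]. Qed.

Lemma counter_inc v t : counter v t -> counter v.+1 (move_head Right t).
Proof.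
case: t => b s a [/= E [[|j] /= ->]] /=; split => //=; try by rewrite E.
- by exists 0%N.
- by exists j.
Qed.

(** The cell that the head leaves stays behind as an explicit blank on the right, which is why
    [counter] allows any number of them. *)
Lemma counter_dec v t : counter v.+1 t -> counter v (move_head Left t).
Proof.
case: t => b s a [/= [-> ->] [j /= ->]] /=.
by case: v => [|v]; split => //=; exists j.+1.
Qed.

Definition env := nat -> nat.

Definition upd (e : env) (i v : nat) : env := fun j => if j == i then v else e j.

Section Registers.
Variable W : nat.

(** Tape 0 is reserved for input and output, hence the shift by one. *)
Definition reg (i : nat) : 'I_W.+1 := inord i.+1.

Definition rep (t : tape) (e : env) (T : tapes W) : Prop :=
  T ord0 = t /\ forall i, (i < W)%N -> counter (e i) (T (reg i)).

Lemma reg0 i : (i < W)%N -> (reg i == ord0) = false.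
Proof.
move=> iW; apply/negbTE/eqP => /(congr1 (@nat_of_ord _)) /=.
by rewrite /reg inordK ?ltnS.
Qed.

Lemma eq_reg i j : (i < W)%N -> (j < W)%N -> (reg i == reg j) = (i == j).
Proof.
move=> iW jW; apply/eqP/eqP => [/(congr1 (@nat_of_ord _))|->] //.
by rewrite /reg !inordK ?ltnS // => -[].
Qed.

Definition set_action (k : 'I_W.+1) (b : symbol * direction) (a : actions W) :
  actions W := [ffun i => if i == k then b else a i].

Lemma act_set_action k b a T i : act (set_action k b a) T i =
  if i == k then move_head b.2 (write_head b.1 (T i)) else act a T i.
Proof. by rewrite !ffunE; case: ifP. Qed.

Definition zero_test (i : nat) (s : symbols W) := s (reg i) == Some true.

Lemma zero_testE t e T i : (i < W)%N -> rep t e T ->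
  zero_test i (scan T) = (e i == 0%N).
Proof. by move=> iW [_ /(_ i iW)/counter0E <-]; rewrite /zero_test ffunE. Qed.

Definition inc_action i (s : symbols W) :=
  set_action (reg i) (s (reg i), Right) (stay s).

(** A head on the mark must not move, or it would leave the counter; this agrees with the
    predecessor of 0 being 0. *)
Definition dec_action i (s : symbols W) :=
  if zero_test i s then stay s else set_action (reg i) (s (reg i), Left) (stay s).

Lemma rep_upd t e (T T' : tapes W) i v : (i < W)%N -> rep t e T ->
  (forall k, k != reg i -> T' k = T k) -> counter v (T' (reg i)) ->
  rep t (upd e i v) T'.
Proof.
move=> iW [T0 Te] TT' T'i; split; first by rewrite TT' // eq_sym reg0.
move=> j jW; rewrite /upd; case: eqP => [->//|/eqP ji].
by rewrite TT' ?eq_reg //; exact: Te.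
Qed.

Lemma write_scanned t : write_head (scanned t) t = t.
Proof. by case: t. Qed.

Lemma rep_inc t e T i : (i < W)%N -> rep t e T ->
  rep t (upd e i (e i).+1) (act (inc_action i (scan T)) T).
Proof.
move=> iW eT; apply: (rep_upd iW eT) => [k /negbTE ki|].
  by rewrite act_set_action ki act_stay.
rewrite act_set_action eqxx ffunE write_scanned; apply: counter_inc.
exact: eT.2.
Qed.

Lemma rep_dec t e T i : (i < W)%N -> rep t e T ->
  rep t (upd e i (e i).-1) (act (dec_action i (scan T)) T).
Proof.
move=> iW eT; rewrite /dec_action (zero_testE iW eT).
case: eqP => [e0|/eqP e0].
  by rewrite act_stay; apply: (rep_upd iW eT) => //; rewrite e0 -[X in counter X]e0; exact: eT.2.
apply: (rep_upd iW eT) => [k /negbTE ki|].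
  by rewrite act_set_action ki act_stay.
rewrite act_set_action eqxx ffunE write_scanned; apply: counter_dec.
by rewrite prednK ?lt0n //; exact: eT.2.
Qed.

End Registers.

(** * Counter programs: syntax, semantics, compilation *)

Inductive cmd :=
  | Inc (i : nat) | Dec (i : nat) | Seq (c d : cmd) | While (i : nat) (c : cmd).

(** Only terminating runs are described. The one loop that may diverge, the search, is later built
    directly from [cwhile]. *)
Inductive exec : cmd -> env -> env -> Prop :=
  | exec_inc i e : exec (Inc i) e (upd e i (e i).+1)
  | exec_dec i e : exec (Dec i) e (upd e i (e i).-1)
  | exec_seq c d e e' e'' : exec c e e' -> exec d e' e'' -> exec (Seq c d) e e''
  | exec_while0 i c e : e i = 0%N -> exec (While i c) e e
  | exec_whileS i c e e' e'' : e i <> 0%N -> exec c e e' ->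
      exec (While i c) e' e'' -> exec (While i c) e e''.

Fixpoint width (c : cmd) : nat :=
  match c with
  | Inc i | Dec i => i.+1
  | Seq c d => maxn (width c) (width d)
  | While i c => maxn i.+1 (width c)
  end.

Fixpoint compile W (c : cmd) : component W :=
  match c with
  | Inc i => prim (inc_action i)
  | Dec i => prim (dec_action i)
  | Seq c d => cseq (compile W c) (compile W d)
  | While i c => cwhile (fun s => ~~ zero_test i s) (compile W c)
  end.

Lemma compileP W c e e' t T : exec c e e' -> (width c <= W)%N -> rep t e T ->
  exists2 T', halts (compile W c) T T' & rep t e' T'.
Proof.
move=> ex; elim: ex T => {c e e'} [i e|i e|c d e e' e'' _ IHc _ IHd|
  i c e ei|i c e e' e'' ei _ IHc _ IHw] T /=.
- by move=> iW eT; eexists; [exact: halts_prim|exact: rep_inc].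
- by move=> iW eT; eexists; [exact: halts_prim|exact: rep_dec].
- rewrite geq_max => /andP[cW dW] /(IHc _ cW)[T1 h1] /(IHd _ dW)[T2 h2 r2].
  by exists T2; first exact: halts_seq h1 h2.
- rewrite geq_max => /andP[iW cW] eT; exists T => //.
  by apply: halts_while_false; rewrite (zero_testE iW eT) ei.
- rewrite geq_max => /andP[iW cW] eT.
  have [T1 h1 /IHw[|T2 h2 r2]] := IHc _ cW eT; first by rewrite /= geq_max iW.
  exists T2 => //; apply: halts_while_true h1 h2.
  by rewrite (zero_testE iW eT); exact/eqP.
Qed.

Lemma env_ext (e e' : env) : (forall i, e i = e' i) -> e = e'.
Proof. exact: funext. Qed.

Lemma exec_eq c e e' e'' : exec c e e' -> (forall i, e' i = e'' i) -> exec c e e''.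
Proof. by move=> ex /env_ext <-. Qed.

Lemma upd_upd e i v w : upd (upd e i v) i w = upd e i w.
Proof. by apply: env_ext => j; rewrite /upd; case: eqP. Qed.

Lemma upd_id e i : upd e i (e i) = e.
Proof. by apply: env_ext => j; rewrite /upd; case: eqP => [->|]. Qed.

Lemma updE e i v : upd e i v i = v.
Proof. by rewrite /upd eqxx. Qed.

Lemma updN e i j v : j != i -> upd e i v j = e j.
Proof. by rewrite /upd => /negbTE ->. Qed.

Lemma exec_loop i c (E : nat -> env) n :
  (forall k, (k < n)%N -> E k i = (n - k)%N /\ exec c (upd (E k) i (n - k).-1) (E k.+1)) ->
  E n i = 0%N -> exec (While i (Seq (Dec i) c)) (E 0%N) (E n).
Proof.
move=> HE En; suff H m : (m <= n)%N -> exec (While i (Seq (Dec i) c)) (E (n - m)%N) (E n).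
  by rewrite -(subnn n); exact: H.
elim: m => [|m IH] mn; first by rewrite subn0; exact: exec_while0.
have [|Ei Ec] := HE (n - m.+1)%N; first by lia.
apply: exec_whileS (IH _); [by rewrite Ei; lia| |by lia].
have -> : (n - m = (n - m.+1).+1)%N by lia.
apply: exec_seq Ec; rewrite -Ei; exact: exec_dec.
Qed.

Definition clear_reg i := While i (Dec i).

Lemma exec_clear i e : exec (clear_reg i) e (upd e i 0%N).
Proof.
move En: (e i) => n; elim: n e En => [|n IH] e En.
  by rewrite -[X in upd e i X]En upd_id; exact: exec_while0.
apply: (@exec_whileS _ _ _ (upd e i n)); first by rewrite En.
  by have := exec_dec i e; rewrite En.
by rewrite -(upd_upd e i n 0); apply: IH; rewrite updE.
Qed.

Definition move_reg i j := While i (Seq (Dec i) (Inc j)).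

Lemma exec_move i j e : i != j ->
  exec (move_reg i j) e (upd (upd e j (e j + e i)) i 0%N).
Proof.
move=> ij; pose E k := upd (upd e j (e j + k)) i (e i - k).
have -> : e = E 0%N by rewrite /E addn0 subn0 upd_id [RHS]upd_id.
have -> : upd (upd (E 0%N) j (E 0%N j + E 0%N i)) i 0 = E (E 0%N i).
  have -> : E 0%N = e by rewrite /E addn0 subn0 upd_id upd_id.
  by rewrite /E subnn.
have -> : E 0%N i = e i by rewrite /E updE subn0.
apply: (exec_loop (E := E)) => [k ki|]; last by rewrite /E updE subnn.
rewrite {1}/E updE; split=> //; apply: exec_eq (exec_inc _ _) _ => l.
by rewrite /E /upd; repeat case: eqP => ? //; subst; rewrite ?eqxx in ij *; lia.
Qed.

(** A counter can only be read by emptying it; [k] takes a second copy, from which [i] is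
    restored. *)
Definition copy_reg i j k := 
  Seq (While i (Seq (Dec i) (Seq (Inc j) (Inc k)))) (move_reg k i).

Lemma exec_copy i j k e : i != j -> i != k -> j != k -> e k = 0%N -> e j = 0%N ->
  exec (copy_reg i j k) e (upd e j (e i)).
Proof.
move=> ij ik jk ek ej; pose E l := upd (upd (upd e j l) k l) i (e i - l).
have E0 : e = E 0%N by rewrite /E subn0 -{1}ej -ek upd_id upd_id upd_id.
apply: (@exec_seq _ _ _ (E (e i))).
  rewrite {1}E0; apply: (exec_loop (E := E)) => [l li|]; last by rewrite /E updE subnn.
  rewrite {1}/E updE; split=> //; apply: exec_seq (exec_inc _ _) _.
  apply: exec_eq (exec_inc _ _) _ => m.
  by clear E0; rewrite /E /upd; repeat case: eqP => ? //; subst; rewrite ?eqxx in ij ik jk *; lia.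
apply: exec_eq (exec_move _ _) _ => [|m]; first by rewrite eq_sym.
by clear E0; rewrite /E /upd; repeat case: eqP => ? //; subst; rewrite ?eqxx in ij ik jk *; lia.
Qed.

(** * Functions computed by counter programs *)

(* [f], as a function of the contents of the registers [rho], can be computed
   into the first free register [b], all registers after [b] being scratch. *)
Definition nat_computable (k : nat) (f : seq nat -> nat) : Prop :=
  forall rho b, size rho = k -> all (fun i => i < b)%N rho ->
  exists c, forall e : env, (forall j, (b <= j)%N -> e j = 0%N) ->
    exec c e (upd e b (f [seq e i | i <- rho])).

Lemma nc_ext k f g : (forall s, size s = k -> f s = g s) ->
  nat_computable k f -> nat_computable k g.
Proof.
move=> fg cf rho b sk /(cf _ _ sk)[c Hc]; exists c => e /Hc.
by rewrite fg // size_map.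
Qed.

Lemma map_upd (rho : seq nat) (e : env) b v : all (fun i => i < b)%N rho ->
  [seq upd e b v i | i <- rho] = [seq e i | i <- rho].
Proof. by move=> /allP rb; apply/eq_in_map => i /rb ib; rewrite updN // ltn_eqF. Qed.

Lemma all_ltW (rho : seq nat) b c : (b <= c)%N -> all (fun i => i < b)%N rho ->
  all (fun i => i < c)%N rho.
Proof. by move=> bc; apply: sub_all => i ib; exact: leq_trans ib bc. Qed.

Lemma nc_var k i : (i < k)%N -> nat_computable k (fun s => nth 0%N s i).
Proof.
move=> ik rho b sk rb; exists (copy_reg (nth 0%N rho i) b b.+1) => e e0.
have ib : (nth 0%N rho i < b)%N by apply: (allP rb); rewrite mem_nth ?sk.
rewrite (nth_map 0%N) ?sk //.
by apply: exec_copy; rewrite ?e0 //; lia.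
Qed.

Lemma nc_zero k : nat_computable k (fun=> 0%N).
Proof.
move=> rho b sk rb; exists (Dec b) => e e0.
by have := exec_dec b e; rewrite e0.
Qed.

Lemma nc_succ k f : nat_computable k f -> nat_computable k (fun s => (f s).+1).
Proof.
move=> cf rho b sk rb; have [c Hc] := cf _ _ sk rb; exists (Seq c (Inc b)) => e e0.
apply: exec_seq (Hc _ e0) _.
by apply: exec_eq (exec_inc _ _) _ => i; rewrite updE upd_upd.
Qed.

(** Composition: the value of [h] in register [b] serves as a new first variable for [g], whose
    result in [b.+1] is then moved down to [b]. *)
Lemma nc_let k h g : nat_computable k h -> nat_computable k.+1 g ->
  nat_computable k (fun s => g (h s :: s)).
Proof.
move=> ch cg rho b sk rb; have [c Hc] := ch _ _ sk rb.
have [|/=|d Hd] := cg (b :: rho) b.+1; first by rewrite /= sk.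
  by rewrite ltnS leqnn; exact: all_ltW rb.
exists (Seq (Seq c d) (Seq (clear_reg b) (move_reg b.+1 b))) => e e0.
apply: exec_seq (exec_seq (Hc _ e0) (Hd _ _)) (exec_seq (exec_clear _ _) _).
  by move=> j bj; rewrite updN ?gtn_eqF // e0 // ltnW.
apply: exec_eq (exec_move _ _) _ => [|i]; first by rewrite gtn_eqF.
have := e0 b.+1 (leqnSn b).
by rewrite /= map_upd // /upd !eqxx; repeat case: eqP => ? //; subst; lia.
Qed.

Lemma nc_sub k l g : all (fun i => i < k)%N l -> nat_computable (size l) g ->
  nat_computable k (fun s => g [seq nth 0%N s i | i <- l]).
Proof.
move=> lk cg rho b sk rb; have [||c Hc] := cg [seq nth 0%N rho i | i <- l] b.
- by rewrite size_map.
- rewrite all_map; apply: sub_all lk => i /= ik.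
  by apply: (allP rb); rewrite mem_nth ?sk.
exists c => e /Hc; rewrite -map_comp; congr (exec _ _ (upd _ _ (g _))).
by apply/eq_in_map => i /(allP lk) ik; rewrite /= (nth_map 0%N) ?sk.
Qed.

Lemma nc_rec k n h g : nat_computable k n -> nat_computable k h ->
  nat_computable k.+2 g ->
  nat_computable k (fun s => iteri (n s) (fun i a => g [:: a, i & s]) (h s)).
Proof.
move=> cn ch cg rho b sk rb.
have [c Hc] := cn _ _ sk rb.
have [//||d Hd] := ch rho b.+2; first by apply: all_ltW rb; lia.
have [||m Hm] := cg [:: b.+2, b.+1 & rho] b.+3; first by rewrite /= sk.
  by rewrite /= !ltnS !leqnn leqnSn; apply: all_ltW rb; lia.
(* Register [b] holds the rounds that remain, [b.+1] the index, [b.+2] the accumulator; its new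
   value appears in [b.+3] and replaces it. *)
pose body := Seq m (Seq (clear_reg b.+2) (Seq (move_reg b.+3 b.+2) (Inc b.+1))).
exists (Seq (Seq c d) (Seq (While b (Seq (Dec b) body))
  (Seq (clear_reg b.+1) (move_reg b.+2 b)))) => e e0.
set s := [seq e i | i <- rho]; set N := n s.
pose G i a := g [:: a, i & s].
pose E j := upd (upd (upd e b (N - j)) b.+1 j) b.+2 (iteri j G (h s)).
have rb1 : all (fun i => i < b.+1)%N rho by apply: all_ltW rb; lia.
have rb2 : all (fun i => i < b.+2)%N rho by apply: all_ltW rb; lia.
apply: (@exec_seq _ _ _ (E 0%N)).
  apply: exec_seq (Hc _ e0) _; apply: exec_eq (Hd _ _) _ => i.
    by move=> bi; rewrite updN ?e0 //; lia.
  rewrite map_upd // -/s /E /= subn0 /upd.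
  by have := e0 b.+1 (leqnSn b); repeat case: eqP => ? //; subst; lia.
apply: (@exec_seq _ _ _ (E N)).
  apply: (exec_loop (E := E)) => [j jN|]; last first.
    by rewrite /E /upd; repeat case: eqP => ?; lia.
  split; first by rewrite /E /upd; repeat case: eqP => ?; lia.
  apply: exec_seq (Hm _ _) _ => [i bi|].
    by rewrite /E !updN ?e0 //; lia.
  rewrite /= (_ : [seq _ | i <- rho] = s); last first.
    by rewrite map_upd // /E !map_upd.
  rewrite (_ : upd _ _ _ _ = iteri j G (h s)); last first.
    by rewrite updN ?gtn_eqF // /E updE.
  rewrite (_ : upd _ _ _ _ = j); last by rewrite /E /upd !eqxx; repeat case: eqP => ?; lia.
  apply: exec_seq (exec_clear _ _) (exec_seq (exec_move _ _) _) => //.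
    by rewrite gtn_eqF.
  apply: exec_eq (exec_inc _ _) _ => i.
  have := e0 b.+3; rewrite /E /upd /=.
  by repeat case: eqP => ? //; subst; rewrite /G /=; lia.
apply: exec_seq (exec_clear _ _) _.
apply: exec_eq (exec_move _ _) _ => [|i]; first by rewrite gtn_eqF //; lia.
have := e0 b.+1; have := e0 b.+2; rewrite /E /upd /= subnn.
by repeat case: eqP => ? //; subst; rewrite /G /=; lia.
Qed.

Lemma map_nth_id (s : seq nat) k : size s = k ->
  [seq nth 0%N s i | i <- iota 0 k] = s.
Proof. by move=> <-; exact: mkseq_nth. Qed.

Lemma nc_weak k f : nat_computable k f ->
  nat_computable k.+2 (fun s => f (drop 2 s)).
Proof.
move=> cf.
have lk : all (fun i => i < k.+2)%N (iota 2 k) by apply/allP => i; rewrite mem_iota; lia.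
have {}cf : nat_computable (size (iota 2 k)) f by rewrite size_iota.
apply: nc_ext (nc_sub lk cf) => -[|a [|b s]] //= [sk].
by rewrite (iotaDl 2 0) -map_comp /= map_nth_id // drop0.
Qed.

Lemma nc_comp1 k g f : nat_computable 1 (fun s => g (nth 0%N s 0)) ->
  nat_computable k f -> nat_computable k (fun s => g (f s)).
Proof.
move=> cg cf; apply: (nc_let (g := fun s => g (nth 0%N s 0)) cf).
by apply: (nc_sub (l := [:: 0%N]) _ cg).
Qed.

Lemma nc_iteri k n h g : nat_computable k n -> nat_computable k h ->
  nat_computable k.+2 (fun s => g (nth 0%N s 1) (nth 0%N s 0) (drop 2 s)) ->
  nat_computable k (fun s => iteri (n s) (fun i a => g i a s) (h s)).
Proof.
move=> cn ch /(nc_rec cn ch); apply: nc_ext => s _ /=; congr iteri.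
by apply: funext => i; apply: funext => a; rewrite drop0.
Qed.

(** * Arithmetic by bounded iteration *)

Lemma nc_const k m : nat_computable k (fun=> m).
Proof. by elim: m => [|m IH]; [exact: nc_zero|exact: nc_succ]. Qed.

Lemma nc_add k f g : nat_computable k f -> nat_computable k g ->
  nat_computable k (fun s => f s + g s)%N.
Proof.
move=> cf cg; apply: nc_ext (nc_iteri (g := fun _ a _ => a.+1) cg cf _) => [s _|].
  by elim: (g s) => [|m /= ->]; rewrite ?addn0 ?addnS.
by apply: nc_succ; exact: nc_var.
Qed.

Lemma nc_pred k f : nat_computable k f -> nat_computable k (fun s => (f s).-1).
Proof.
move=> cf; apply: nc_ext (nc_iteri (g := fun i _ _ => i) cf (@nc_zero _) _).
  by move=> s _; case: (f s).
exact: nc_var.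
Qed.

Lemma nc_subn k f g : nat_computable k f -> nat_computable k g ->
  nat_computable k (fun s => f s - g s)%N.
Proof.
move=> cf cg; apply: nc_ext (nc_iteri (g := fun _ a _ => a.-1) cg cf _) => [s _|].
  by elim: (g s) => [|m /= ->]; rewrite ?subn0 ?subnS.
by apply: nc_pred; exact: nc_var.
Qed.

Lemma nc_mul k f g : nat_computable k f -> nat_computable k g ->
  nat_computable k (fun s => f s * g s)%N.
Proof.
move=> cf cg; apply: nc_ext (nc_iteri (g := fun _ a s => a + g s)%N cf (@nc_zero _) _).
  by move=> s _; elim: (f s) => //= m ->; rewrite mulSn addnC.
by apply: nc_add; [exact: nc_var|exact: nc_weak].
Qed.

Lemma nc_exp2 k f : nat_computable k f -> nat_computable k (fun s => 2 ^ f s)%N.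
Proof.
move=> cf; apply: nc_ext (nc_iteri (g := fun _ a s => a + a)%N cf (@nc_const _ 1) _).
  by move=> s _; elim: (f s) => //= m ->; rewrite expnS mul2n addnn.
by apply: nc_add; exact: nc_var.
Qed.

(** A conditional is the iteration of a constant function: with no round at all the initial value
    survives. *)
Lemma nc_if k c f g : nat_computable k c -> nat_computable k f ->
  nat_computable k g -> nat_computable k (fun s => if c s == 0%N then g s else f s).
Proof.
move=> cc cf cg; apply: nc_ext (nc_iteri (g := fun _ _ s => f s) cc cg _).
  by move=> s _; case: (c s).
exact: nc_weak.
Qed.

Lemma nc_eq k f g : nat_computable k f -> nat_computable k g ->
  nat_computable k (fun s => f s == g s : nat).
Proof.
move=> cf cg; apply: nc_ext (nc_if (nc_add (nc_subn cf cg) (nc_subn cg cf))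
  (@nc_const _ 0) (@nc_const _ 1)) => s _.
by rewrite addn_eq0 !subn_eq0 -eqn_leq; case: eqP.
Qed.

Lemma nc_half k f : nat_computable k f -> nat_computable k (fun s => (f s)./2).
Proof.
(* The recursion used is that half of m + 1, rounded down, equals m minus half of m, rounded
   down. *)
move=> cf; apply: nc_ext (nc_iteri (g := fun i a _ => i - a)%N cf (@nc_zero _) _).
  move=> s _; elim: (f s) => //= m ->.
  by have := odd_double_half m; have := odd_double_half m.+1; rewrite /=; lia.
by apply: nc_subn; exact: nc_var.
Qed.

Lemma nc_iter_half k m f : nat_computable k m -> nat_computable k f ->
  nat_computable k (fun s => iter (m s) half (f s)).
Proof.
move=> cm cf; apply: nc_ext (nc_iteri (g := fun _ a _ => a./2) cm cf _).
  by move=> s _; elim: (m s) => //= l ->.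
by apply: nc_half; exact: nc_var.
Qed.

(* The pairing of LISP: [0] is the empty list. *)
Definition cons_nat (a b : nat) : nat := (2 ^ a * b.*2.+1)%N.

(** The exponent of 2 in [z], found by bounded search; divisibility by a power of 2 is tested by
    halving and multiplying back. *)
Definition head_nat (z : nat) : nat :=
  iteri z (fun i a => if 2 ^ i.+1 * iter i.+1 half z == z then i.+1 else a)%N 0%N.

(** One halving beyond the exponent removes the last 1 of the odd factor. *)
Definition tail_nat (z : nat) : nat := iter (head_nat z).+1 half z.

Lemma iter_half i z : iter i half z = (z %/ 2 ^ i)%N.
Proof. by elim: i => [|i /= ->]; rewrite ?divn1 // -divn2 -divnMA expnSr. Qed.

Lemma cons_natK1 a b : head_nat (cons_nat a b) = a.
Proof.
rewrite /head_nat; set z := cons_nat a b.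
suff H m : iteri m (fun i a => if 2 ^ i.+1 * iter i.+1 half z == z then i.+1 else a)%N 0%N
    = minn m a.
  rewrite H; apply/minn_idPr; rewrite /z /cons_nat.
  by apply: leq_trans (ltnW (ltn_expl a (ltnSn 1))) _; rewrite leq_pmulr.
elim: m => [|m IH] /=; first by rewrite min0n.
rewrite IH -/(iter m.+1 half z) iter_half mulnC -dvdn_eq /z /cons_nat.
have [ma|am] := ltnP m a.
  by rewrite dvdn_mulr ?dvdn_exp2l //; apply/esym/minn_idPl.
(* For m at least a, divisibility by 2^(m+1) would make the odd factor even. *)
rewrite (_ : _ %| _ = false)%N; first by rewrite /minn; do 2 case: ltnP; lia.
apply/negP; rewrite -(subnKC am) -addnS expnD dvdn_pmul2l ?expn_gt0 //.
by move=> /(dvdn_trans (dvdn_exp2l 2 (ltn0Sn (m - a)))); rewrite dvdn2 /= odd_double.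
Qed.

Lemma cons_natK2 a b : tail_nat (cons_nat a b) = b.
Proof.
rewrite /tail_nat cons_natK1 iter_half /cons_nat expnSr divnMA mulKn ?expn_gt0 //.
by rewrite -addn1 -muln2 divnMDl // addn0.
Qed.

Lemma nc_cons k f g : nat_computable k f -> nat_computable k g ->
  nat_computable k (fun s => cons_nat (f s) (g s)).
Proof.
move=> cf cg; apply: nc_mul; first exact: nc_exp2.
apply: nc_succ; apply: nc_ext (nc_add cg cg) => s _; exact: addnn.
Qed.

Lemma nc_head k f : nat_computable k f -> nat_computable k (fun s => head_nat (f s)).
Proof.
apply: nc_comp1.
apply: (nc_iteri (g := fun i a s =>
  if 2 ^ i.+1 * iter i.+1 half (nth 0%N s 0) == nth 0%N s 0 then i.+1 else a)%N).
- exact: nc_var.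
- exact: nc_zero.
have c0 := @nc_var 3 0 erefl; have c1 := nc_succ (@nc_var 3 1 erefl).
have c2 := @nc_var 3 2 erefl.
have := nc_if (nc_eq (nc_mul (nc_exp2 c1) (nc_iter_half c1 c2)) c2) c1 c0.
by apply: nc_ext => -[|? [|? [|? []]]] //= _; rewrite eqb0 if_neg.
Qed.

Lemma nc_tail k f : nat_computable k f -> nat_computable k (fun s => tail_nat (f s)).
Proof.
apply: nc_comp1; have c := @nc_var 1 0 erefl.
exact (nc_iter_half (nc_succ (nc_head c)) c).
Qed.

(** * Computable functions between encoded types *)

(** Injectivity is enough: a computable function may behave arbitrarily on numbers that are no
    code. *)
Class encoding (A : Type) := Encoding {
  enc : A -> nat;
  enc_inj : injective enc }.

#[global] Instance nat_encoding : encoding nat := @Encoding nat id (fun _ _ e => e).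

#[global] Instance bool_encoding : encoding bool.
Proof. by exists nat_of_bool; case=> [] []. Defined.

#[global] Instance prod_encoding A B `{encoding A} `{encoding B} :
  encoding (A * B).
Proof.
exists (fun p => cons_nat (enc p.1) (enc p.2)) => -[a b] [a' b'] /= E.
have := congr1 head_nat E; rewrite !cons_natK1 => /(@enc_inj A _) ->.
by have := congr1 tail_nat E; rewrite !cons_natK2 => /(@enc_inj B _) ->.
Defined.

Lemma cons_nat_gt0 a b : (0 < cons_nat a b)%N.
Proof. by rewrite muln_gt0 expn_gt0. Qed.

#[global] Instance seq_encoding A `{encoding A} : encoding (seq A).
Proof.
exists (fun s => foldr (fun a z => cons_nat (enc a) z) 0%N s).
elim=> [|a s IH] [|b t] //= E.
- by move/eqP: E; rewrite ltn_eqF ?cons_nat_gt0.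
- by move/eqP: E; rewrite gtn_eqF ?cons_nat_gt0.
- have := congr1 head_nat E; rewrite !cons_natK1 => /(@enc_inj A _) ->.
  by have := congr1 tail_nat E; rewrite !cons_natK2 => /IH ->.
Defined.

#[global] Instance option_encoding A `{encoding A} : encoding (option A).
Proof.
by exists (fun o => if o is Some a then (enc a).+1 else 0%N);
  move=> [a|] [b|] //= [/(@enc_inj A _) ->].
Defined.

Lemma enc_cons A `{encoding A} (a : A) s : enc (a :: s) = cons_nat (enc a) (enc s).
Proof. by []. Qed.

Lemma enc_pair A B `{encoding A} `{encoding B} (a : A) (b : B) :
  enc (a, b) = cons_nat (enc a) (enc b).
Proof. by []. Qed.

Lemma enc_some A `{encoding A} (a : A) : enc (Some a) = (enc a).+1.
Proof. by []. Qed.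

Definition nat_computable1 (g : nat -> nat) :=
  nat_computable 1 (fun s => g (nth 0%N s 0)).

(* An inductive type rather than an [exists2], lest unification unfold it. *)
Inductive computable A B `{encoding A} `{encoding B} (f : A -> B) : Prop :=
  Computable g of nat_computable1 g & forall a, g (enc a) = enc (f a).

Section Closure.
Context {X A B C : Type} `{encX : encoding X} `{encA : encoding A}
  `{encB : encoding B} `{encC : encoding C}.

Lemma comp_id : computable (fun x : X => x).
Proof. by exists id => //; exact: nc_var. Qed.

Lemma comp_const (b : B) : computable (fun x : X => b).
Proof. by exists (fun=> enc b) => //; exact: nc_const. Qed.

Lemma comp_comp (f : A -> B) (g : X -> A) : computable f -> computable g ->
  computable (fun x => f (g x)).
Proof.
move=> [f' cf Hf] [g' cg Hg]; exists (fun z => f' (g' z)).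
  exact: (nc_comp1 (f := fun s => g' (nth 0%N s 0))).
by move=> x; rewrite Hg Hf.
Qed.

Lemma comp_pair (f : X -> A) (g : X -> B) : computable f -> computable g ->
  computable (fun x => (f x, g x)).
Proof.
move=> [f' cf Hf] [g' cg Hg]; exists (fun z => cons_nat (f' z) (g' z)).
  exact: (nc_cons (f := fun s => f' (nth 0%N s 0)) (g := fun s => g' (nth 0%N s 0))).
by move=> x; rewrite Hg Hf.
Qed.

Lemma comp_fst (f : X -> A * B) : computable f -> computable (fun x => (f x).1).
Proof.
move=> [f' cf Hf]; exists (fun z => head_nat (f' z)).
  exact: (nc_head (f := fun s => f' (nth 0%N s 0))).
by move=> x; rewrite Hf cons_natK1.
Qed.

Lemma comp_snd (f : X -> A * B) : computable f -> computable (fun x => (f x).2).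
Proof.
move=> [f' cf Hf]; exists (fun z => tail_nat (f' z)).
  exact: (nc_tail (f := fun s => f' (nth 0%N s 0))).
by move=> x; rewrite Hf cons_natK2.
Qed.

End Closure.

Section ClosureBis.
Context {X A B : Type} `{encX : encoding X} `{encA : encoding A}
  `{encB : encoding B}.

Lemma comp_iteri (n : X -> nat) (h : X -> A) (g : X -> nat -> A -> A) :
  computable n -> computable h ->
  computable (fun y : X * (nat * A) => g y.1 y.2.1 y.2.2) ->
  computable (fun x => iteri (n x) (g x) (h x)).
Proof.
move=> [n' cn Hn] [h' ch Hh] [g' cg Hg].
exists (fun z => iteri (n' z) (fun i a => g' (cons_nat z (cons_nat i a))) (h' z)).
  apply: (nc_iteri (n := fun s => n' (nth 0%N s 0)) (h := fun s => h' (nth 0%N s 0))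
    (g := fun i a s => g' (cons_nat (nth 0%N s 0) (cons_nat i a)))) => //.
  apply: (nc_comp1 (g := g') cg).
  have c0 := @nc_var 3 0 erefl; have c1 := @nc_var 3 1 erefl.
  have c2 := @nc_var 3 2 erefl.
  by apply: nc_ext (nc_cons c2 (nc_cons c1 c0)) => -[|? [|? [|? []]]].
move=> x; rewrite Hn Hh -[enc (n x)]/(n x).
by elim: (n x) => //= m ->; rewrite -(Hg (x, (m, _))).
Qed.

Lemma comp_if (c : X -> bool) (f g : X -> A) : computable c -> computable f ->
  computable g -> computable (fun x => if c x then f x else g x).
Proof.
move=> [c' cc Hc] [f' cf Hf] [g' cg Hg].
exists (fun z => if c' z == 0%N then g' z else f' z).
  exact: (nc_if (c := fun s => c' (nth 0%N s 0)) (f := fun s => f' (nth 0%N s 0))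
    (g := fun s => g' (nth 0%N s 0))).
by move=> x; rewrite Hc Hf Hg; case: (c x).
Qed.

Lemma comp_enc : computable (fun x : X => enc x).
Proof. by exists id => //; exact: nc_var. Qed.

Lemma computable_ext (f g : X -> A) : (forall x, f x = g x) -> computable f ->
  computable g.
Proof. by move=> fg [f' cf Hf]; exists f' => // x; rewrite Hf fg. Qed.

(** Serves for constructors and projections of types whose code is that of a tuple. *)
Lemma comp_recode (r : A -> B) (f : X -> A) : (forall a, enc (r a) = enc a) ->
  computable f -> computable (fun x => r (f x)).
Proof. by move=> rE [f' cf Hf]; exists f' => // x; rewrite Hf rE. Qed.

End ClosureBis.

Section Nat.
Context {X : Type} `{encX : encoding X}.
Implicit Types (f g : X -> nat) (b c : X -> bool).

Lemma comp_succ f : computable f -> computable (fun x => (f x).+1).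
Proof.
move=> [f' cf Hf]; exists (fun z => (f' z).+1).
  exact: (nc_succ (f := fun s => f' (nth 0%N s 0))).
by move=> x; rewrite Hf.
Qed.

Lemma comp_pred f : computable f -> computable (fun x => (f x).-1).
Proof.
move=> [f' cf Hf]; exists (fun z => (f' z).-1).
  exact: (nc_pred (f := fun s => f' (nth 0%N s 0))).
by move=> x; rewrite Hf.
Qed.

Lemma comp_add f g : computable f -> computable g -> computable (fun x => f x + g x)%N.
Proof.
move=> [f' cf Hf] [g' cg Hg]; exists (fun z => f' z + g' z)%N.
  exact: (nc_add (f := fun s => f' (nth 0%N s 0)) (g := fun s => g' (nth 0%N s 0))).
by move=> x; rewrite Hf Hg.
Qed.

Lemma comp_sub f g : computable f -> computable g -> computable (fun x => f x - g x)%N.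
Proof.
move=> [f' cf Hf] [g' cg Hg]; exists (fun z => f' z - g' z)%N.
  exact: (nc_subn (f := fun s => f' (nth 0%N s 0)) (g := fun s => g' (nth 0%N s 0))).
by move=> x; rewrite Hf Hg.
Qed.

Lemma comp_mul f g : computable f -> computable g -> computable (fun x => f x * g x)%N.
Proof.
move=> [f' cf Hf] [g' cg Hg]; exists (fun z => f' z * g' z)%N.
  exact: (nc_mul (f := fun s => f' (nth 0%N s 0)) (g := fun s => g' (nth 0%N s 0))).
by move=> x; rewrite Hf Hg.
Qed.

Lemma comp_exp2 f : computable f -> computable (fun x => 2 ^ f x)%N.
Proof.
move=> [f' cf Hf]; exists (fun z => 2 ^ f' z)%N.
  exact: (nc_exp2 (f := fun s => f' (nth 0%N s 0))).
by move=> x; rewrite Hf.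
Qed.

Lemma comp_eq (A : eqType) `{encoding A} (f g : X -> A) :
  computable f -> computable g -> computable (fun x => f x == g x).
Proof.
move=> [f' cf Hf] [g' cg Hg]; exists (fun z => f' z == g' z).
  exact: (nc_eq (f := fun s => f' (nth 0%N s 0)) (g := fun s => g' (nth 0%N s 0))).
by move=> x; rewrite Hf Hg /= (inj_eq enc_inj).
Qed.

Lemma comp_leq f g : computable f -> computable g -> computable (fun x => f x <= g x)%N.
Proof. by move=> cf cg; exact: comp_eq (comp_sub cf cg) (comp_const _). Qed.

Lemma comp_neg b : computable b -> computable (fun x => ~~ b x).
Proof.
by move=> cb; apply: computable_ext (comp_if cb (comp_const false) (comp_const true)) => x;
  case: (b x).
Qed.

Lemma comp_and b c : computable b -> computable c -> computable (fun x => b x && c x).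
Proof.
by move=> cb cc; apply: computable_ext (comp_if cb cc (comp_const false)) => x;
  case: (b x).
Qed.

Lemma comp_head f : computable f -> computable (fun x => head_nat (f x)).
Proof.
move=> [f' cf Hf]; exists (fun z => head_nat (f' z)).
  exact: (nc_head (f := fun s => f' (nth 0%N s 0))).
by move=> x; rewrite Hf.
Qed.

Lemma comp_tail f : computable f -> computable (fun x => tail_nat (f x)).
Proof.
move=> [f' cf Hf]; exists (fun z => tail_nat (f' z)).
  exact: (nc_tail (f := fun s => f' (nth 0%N s 0))).
by move=> x; rewrite Hf.
Qed.

End Nat.

(** * Lists and options *)

Section Seq.
Context {X A B : Type} `{encX : encoding X} `{encA : encoding A} `{encB : encoding B}.

Lemma comp_cons (f : X -> A) (g : X -> seq A) : computable f -> computable g ->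
  computable (fun x => f x :: g x).
Proof.
move=> cf cg; have [h ch Hh] := comp_pair cf cg.
by exists h => // x; rewrite Hh.
Qed.

Lemma comp_some (f : X -> A) : computable f -> computable (fun x => Some (f x)).
Proof.
move=> [f' cf Hf]; exists (fun z => (f' z).+1).
  exact: (nc_succ (f := fun s => f' (nth 0%N s 0))).
by move=> x; rewrite Hf.
Qed.

Lemma comp_scase (s : X -> seq A) (h : X -> B) (g : X -> A -> seq A -> B) :
  computable s -> computable h ->
  computable (fun y : X * (A * seq A) => g y.1 y.2.1 y.2.2) ->
  computable (fun x => if s x is a :: l then g x a l else h x).
Proof.
move=> [s' cs Hs] [h' ch Hh] [g' cg Hg].
exists (fun z => if s' z == 0%N then h' z else g' (cons_nat z (s' z))).
  apply: (nc_if (c := fun s => s' (nth 0%N s 0)) (g := fun s => h' (nth 0%N s 0))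
    (f := fun s => g' (cons_nat (nth 0%N s 0) (s' (nth 0%N s 0))))) => //.
  by apply: nc_comp1 => //; apply: nc_cons => //; exact: nc_var.
move=> x; rewrite Hs; case: (s x) => [|a l]; first by rewrite /= Hh.
rewrite enc_cons ifF; first by rewrite -(Hg (x, (a, l))).
by rewrite gtn_eqF ?cons_nat_gt0.
Qed.

Lemma comp_ocase (o : X -> option A) (h : X -> B) (g : X -> A -> B) :
  computable o -> computable h ->
  computable (fun y : X * A => g y.1 y.2) ->
  computable (fun x => if o x is Some a then g x a else h x).
Proof.
move=> [s' cs Hs] [h' ch Hh] [g' cg Hg].
exists (fun z => if s' z == 0%N then h' z else g' (cons_nat z (s' z).-1)).
  apply: (nc_if (c := fun s => s' (nth 0%N s 0)) (g := fun s => h' (nth 0%N s 0))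
    (f := fun s => g' (cons_nat (nth 0%N s 0) (s' (nth 0%N s 0)).-1))) => //.
  apply: nc_comp1 => //; apply: nc_cons; first exact: nc_var.
  exact: (nc_pred (f := fun s => s' (nth 0%N s 0))).
move=> x; rewrite Hs; case: (o x) => [a|]; last by rewrite /= Hh.
by rewrite enc_some /= -(Hg (x, a)).
Qed.

End Seq.

Section Apply.
Context {Y X A B C : Type} `{encY : encoding Y} `{encX : encoding X}
  `{encA : encoding A} `{encB : encoding B} `{encC : encoding C}.

Lemma comp_app2 (g : X -> A -> C) (x : Y -> X) (a : Y -> A) :
  computable (fun y : X * A => g y.1 y.2) -> computable x -> computable a ->
  computable (fun y => g (x y) (a y)).
Proof. by move=> cg cx ca; exact: (comp_comp cg (comp_pair cx ca)). Qed.

Lemma comp_app3 (g : X -> A -> B -> C) (x : Y -> X) (a : Y -> A) (b : Y -> B) :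
  computable (fun y : X * (A * B) => g y.1 y.2.1 y.2.2) ->
  computable x -> computable a -> computable b ->
  computable (fun y => g (x y) (a y) (b y)).
Proof.
by move=> cg cx ca cb; exact: (comp_comp cg (comp_pair cx (comp_pair ca cb))).
Qed.

End Apply.

Section Fold.
Context {X A B : Type} `{encX : encoding X} `{encA : encoding A} `{encB : encoding B}.

(** The code of a list bounds its length, so a fold can be run for [enc s] rounds. *)
Lemma size_enc (s : seq A) : (size s <= enc s)%N.
Proof.
elim: s => // a s IH; rewrite enc_cons /cons_nat [size _]/=.
apply: (@leq_trans (enc s).*2.+1); last by rewrite leq_pmull ?expn_gt0.
by rewrite ltnS (leq_trans IH) // -addnn leq_addr.
Qed.

Lemma comp_foldl (s : X -> seq A) (h : X -> B) (g : X -> B -> A -> B) :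
  computable s -> computable h ->
  computable (fun y : X * (B * A) => g y.1 y.2.1 y.2.2) ->
  computable (fun x => foldl (g x) (h x) (s x)).
Proof.
move=> cs ch cg.
pose st x (p : seq A * B) := if p.1 is a :: l then (l, g x p.2 a) else p.
apply: (@computable_ext _ _ _ _
    (fun x => (iteri (enc (s x)) (fun _ => st x) (s x, h x)).2)).
  move=> x; have := size_enc (s x); move: (enc (s x)) => n.
  have iterE k p : iteri k (fun _ => st x) p = iter k (st x) p by elim: k => //= k ->.
  rewrite iterE; elim: n (s x) (h x) => [|n IH] [|a l] b // nl.
    suff -> : iter n.+1 (st x) ([::], b) = ([::], b) by [].
    by elim: n.+1 => //= k ->.
  by rewrite iterSr; exact: IH.
apply: comp_snd; apply: comp_iteri; [exact: comp_comp comp_enc cs|exact: comp_pair|].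
have c0 : computable (fun y : X * (nat * (seq A * B)) => y.2.2).
  by apply: comp_snd; apply: comp_snd; exact: comp_id.
apply: comp_scase; [exact: comp_fst|exact: c0|].
apply: comp_pair; first by apply: comp_snd; apply: comp_snd; exact: comp_id.
apply: (comp_app3 cg).
- by do 2 apply: comp_fst; exact: comp_id.
- by do 3 apply: comp_snd; apply: comp_fst; exact: comp_id.
- by apply: comp_fst; apply: comp_snd; exact: comp_id.
Qed.

End Fold.

(** Rebound with [::=] as closure lemmas accumulate, so that [comp] covers each new operation. *)
Ltac comp_hook := fail.

Ltac comp_step := first
  [ assumption
  | exact: comp_id
  | exact: comp_const
  | apply: comp_head | apply: comp_tail
  | match goal with H : computable ?g |- computable (fun x => ?g (@?h x)) =>
      apply: (comp_comp (g := h) H) end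
  | match goal with H : computable _ |- _ =>
      first [apply: (comp_app2 H) | apply: (comp_app3 H)] end
  | comp_hook
  | apply: comp_fst | apply: comp_snd | apply: comp_pair
  | apply: comp_succ | apply: comp_pred | apply: comp_add | apply: comp_sub
  | apply: comp_mul | apply: comp_exp2 | apply: comp_leq | apply: comp_eq
  | apply: comp_neg | apply: comp_and
  | apply: comp_some
  | apply: comp_cons | apply: comp_foldl | apply: comp_iteri
  | apply: comp_if | apply: comp_scase | apply: comp_ocase
  | apply: (comp_comp comp_enc) ].
Ltac comp := repeat (comp_step; cbn beta).

Section Derived.
Context {X A B : Type} `{encX : encoding X} `{encA : encoding A} `{encB : encoding B}.

Lemma comp_catrev (f g : X -> seq A) : computable f -> computable g ->
  computable (fun x => catrev (f x) (g x)).
Proof.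
move=> cf cg; apply: (@computable_ext _ _ _ _
  (fun x => foldl (fun acc a => a :: acc) (g x) (f x))).
  by move=> x; elim: (f x) (g x) => //= a s IH t; rewrite IH.
by comp.
Qed.

Lemma comp_rev (f : X -> seq A) : computable f -> computable (fun x => rev (f x)).
Proof. by move=> cf; apply: comp_catrev => //; comp. Qed.

Lemma comp_cat (f g : X -> seq A) : computable f -> computable g ->
  computable (fun x => f x ++ g x).
Proof.
move=> cf cg; apply: (@computable_ext _ _ _ _ (fun x => catrev (rev (f x)) (g x))).
  by move=> x; rewrite catrevE revK.
by apply: comp_catrev => //; exact: comp_rev.
Qed.

End Derived.

Section Map.
Context {X A B : Type} `{encX : encoding X} `{encA : encoding A} `{encB : encoding B}.

Lemma comp_map (s : X -> seq A) (g : X -> A -> B) : computable s ->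
  computable (fun y : X * A => g y.1 y.2) ->
  computable (fun x => map (g x) (s x)).
Proof.
move=> cs cg; apply: (@computable_ext _ _ _ _
    (fun x => rev (foldl (fun acc a => g x a :: acc) [::] (s x)))).
  move=> x; set t := [::]; rewrite -[RHS]/(rev t ++ _); move: t.
  elim: (s x) => [|a l IH] t /=; first by rewrite cats0.
  by rewrite IH rev_cons cat_rcons.
apply: comp_rev; apply: comp_foldl; comp.
Qed.

Lemma comp_size (s : X -> seq A) : computable s -> computable (fun x => size (s x)).
Proof.
move=> cs; apply: (@computable_ext _ _ _ _ (fun x => foldl (fun n _ => n.+1) 0%N (s x))).
  move=> x; rewrite -[RHS]add0n; move: 0%N; elim: (s x) => [|a l IH] n /=; first by rewrite addn0.
  by rewrite IH addSnnS.
by comp.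
Qed.

Lemma comp_all (s : X -> seq A) (g : X -> A -> bool) : computable s ->
  computable (fun y : X * A => g y.1 y.2) ->
  computable (fun x => all (g x) (s x)).
Proof.
move=> cs cg; apply: (@computable_ext _ _ _ _
    (fun x => foldl (fun b a => b && g x a) true (s x))).
  move=> x; rewrite -[RHS]andTb; move: true; elim: (s x) => [|a l IH] b /=.
    by rewrite andbT.
  by rewrite IH andbA.
by comp.
Qed.

Lemma comp_has (s : X -> seq A) (g : X -> A -> bool) : computable s ->
  computable (fun y : X * A => g y.1 y.2) ->
  computable (fun x => has (g x) (s x)).
Proof.
move=> cs cg; apply: (@computable_ext _ _ _ _
    (fun x => ~~ all (fun a => ~~ g x a) (s x))).
  by move=> x; rewrite -has_predC; apply: eq_has => a /=; rewrite negbK.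
by apply: comp_neg; apply: comp_all => //; apply: comp_neg.
Qed.

Lemma comp_flatten (s : X -> seq (seq A)) : computable s ->
  computable (fun x => flatten (s x)).
Proof.
move=> cs; apply: (@computable_ext _ _ _ _
    (fun x => foldl (fun acc a => acc ++ a) [::] (s x))).
  move=> x; rewrite -[RHS]/([::] ++ _); move: [::]; elim: (s x) => [|a l IH] t /=.
    by rewrite cats0.
  by rewrite IH catA.
comp; apply: comp_cat; comp.
Qed.

Lemma comp_iter (n : X -> nat) (h : X -> A) (g : X -> A -> A) :
  computable n -> computable h ->
  computable (fun y : X * A => g y.1 y.2) ->
  computable (fun x => iter (n x) (g x) (h x)).
Proof.
move=> cn ch cg; apply: (@computable_ext _ _ _ _
    (fun x => iteri (n x) (fun _ a => g x a) (h x))).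
  by move=> x; elim: (n x) => //= m ->.
apply: comp_iteri; comp.
Qed.

End Map.

Section Nth.
Context {X A B : Type} `{encX : encoding X} `{encA : encoding A} `{encB : encoding B}.

Lemma comp_nth (d : X -> A) (s : X -> seq A) (n : X -> nat) :
  computable d -> computable s -> computable n ->
  computable (fun x => nth (d x) (s x) (n x)).
Proof.
move=> cd cs cn; apply: (@computable_ext _ _ _ _
  (fun x => if iter (n x) behead (s x) is a :: _ then a else d x)).
  by move=> x; elim: (n x) (s x) => [|m IH] [|a l] //; rewrite iterSr IH /= ?nth_nil.
apply: comp_scase; comp.
apply: comp_iter; comp; apply: comp_scase; comp.
Qed.

Lemma comp_mkseq (n : X -> nat) (g : X -> nat -> A) : computable n ->
  computable (fun y : X * nat => g y.1 y.2) ->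
  computable (fun x => mkseq (g x) (n x)).
Proof.
move=> cn cg; apply: (@computable_ext _ _ _ _
  (fun x => iteri (n x) (fun i s => s ++ [:: g x i]) [::])).
  by move=> x; elim: (n x) => //= m ->; rewrite mkseqS cats1.
apply: comp_iteri; comp; apply: comp_cat; comp.
Qed.

End Nth.

Ltac comp_seq := first
  [ apply: comp_mkseq | apply: comp_flatten | apply: comp_map | apply: comp_size
  | apply: comp_all | apply: comp_has | apply: comp_rev | apply: comp_catrev
  | apply: comp_cat | apply: comp_iter | apply: comp_nth ].

Ltac comp_hook ::= comp_seq.

(** Bounded search for the end of an initial segment; quotient and logarithm are instances. *)
Lemma iteri_largest (P : pred nat) n k : (forall i, (0 < i)%N -> P i = (i <= k)%N) ->
  (k <= n)%N -> iteri n (fun i a => if P i.+1 then i.+1 else a) 0%N = k.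
Proof.
move=> Pk kn; suff H m : iteri m (fun i a => if P i.+1 then i.+1 else a) 0%N = minn m k.
  by rewrite H; exact/minn_idPr.
elim: m => [|m IH]; first by rewrite min0n.
by rewrite /= Pk // IH; case: ltnP; lia.
Qed.

Section Arith.
Context {X : Type} `{encX : encoding X}.
Implicit Types (f g : X -> nat).

Lemma comp_odd f : computable f -> computable (fun x => odd (f x)).
Proof.
move=> cf; apply: (@computable_ext _ _ _ _ (fun x => iter (f x) negb false)); last by comp.
by move=> x; elim: (f x) => //= n ->.
Qed.

Lemma comp_divn f g : computable f -> computable g -> computable (fun x => f x %/ g x)%N.
Proof.
move=> cf cg; apply: (@computable_ext _ _ _ _ (fun x => (if g x == 0%N then 0%N else
  iteri (f x) (fun i a => if i.+1 * g x <= f x then i.+1 else a) 0)%N)); last by comp.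
move=> x; case: eqP => [->|/eqP g0]; first by rewrite divn0.
rewrite (@iteri_largest (fun i => i * g x <= f x)%N (f x) (f x %/ g x)) ?leq_div //.
by move=> i _; rewrite leq_divRL // lt0n.
Qed.

Lemma comp_trunc_log2 f : computable f -> computable (fun x => trunc_log 2 (f x)).
Proof.
move=> cf; apply: (@computable_ext _ _ _ _ (fun x =>
  iteri (f x) (fun i a => if 2 ^ i.+1 <= f x then i.+1 else a) 0)%N); last by comp.
move=> x; case: (posnP (f x)) => [->|f0]; first by rewrite trunc_log0.
apply: (@iteri_largest (fun i => 2 ^ i <= f x)%N) => [i _|].
  apply/idP/idP; first exact: trunc_log_max.
  by move=> le; apply: leq_trans (@trunc_logP 2 _ isT f0); rewrite leq_exp2l.
by apply: leq_trans (@trunc_logP 2 _ isT f0); apply: ltnW; exact: ltn_expl.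
Qed.

End Arith.

#[global] Instance int_encoding : encoding int.
Proof.
exists (fun z => match z with Posz n => enc (false, n) | Negz n => enc (true, n) end).
by move=> [m|m] [n|n] /(@enc_inj (bool * nat) _) // [->].
Defined.

Section Int.
Context {X A : Type} `{encX : encoding X} `{encA : encoding A}.

Lemma comp_Posz (f : X -> nat) : computable f -> computable (fun x => Posz (f x)).
Proof.
move=> cf; have [g cg Hg] := comp_pair (comp_const false) cf.
by exists g => // x; rewrite Hg.
Qed.

Lemma comp_Negz (f : X -> nat) : computable f -> computable (fun x => Negz (f x)).
Proof.
move=> cf; have [g cg Hg] := comp_pair (comp_const true) cf.
by exists g => // x; rewrite Hg.
Qed.

Definition int_split (z : int) : bool * nat :=
  match z with Posz n => (false, n) | Negz n => (true, n) end.

Lemma comp_intcase (z : X -> int) (g h : X -> nat -> A) : computable z ->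
  computable (fun y : X * nat => g y.1 y.2) -> computable (fun y : X * nat => h y.1 y.2) ->
  computable (fun x => match z x with Posz n => g x n | Negz n => h x n end).
Proof.
move=> cz cg ch.
have cs : computable (fun x => int_split (z x)).
  by apply: comp_recode cz => -[].
apply: (@computable_ext _ _ _ _ (fun x => if (int_split (z x)).1
    then h x (int_split (z x)).2 else g x (int_split (z x)).2)).
  by move=> x; case: (z x).
by apply: comp_if; [comp|apply: (comp_app2 ch); comp|apply: (comp_app2 cg); comp].
Qed.

End Int.

(** * Functions on finite types and finite tuples *)

Section Finite.

(** A finite table of cases, whatever the encodings; the transition function of a machine is handled
    this way. *)
Lemma comp_finite (A : finType) (B : Type) `{encA : encoding A} `{encB : encoding B}
  (f : A -> B) : computable f.
Proof.
suff [g cg Hg] : exists2 g, nat_computable1 g &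
    forall a : A, a \in enum A -> g (@enc A encA a) = @enc B encB (f a).
  by exists g => // a; apply: Hg; rewrite mem_enum.
elim: (enum A) => [|a s [g cg Hg]]; first by exists (fun=> 0%N) => //; exact: nc_zero.
exists (fun z => if (z == @enc A encA a : nat) == 0%N then g z else enc (f a)).
  apply: (nc_if (c := fun s => (nth 0%N s 0 == @enc A encA a : nat))
    (f := fun=> enc (f a)) (g := fun s => g (nth 0%N s 0))) => //.
    by apply: nc_eq; [exact: nc_var|exact: nc_const].
  exact: nc_const.
move=> b; rewrite inE /= (inj_eq (@enc_inj A _)); case: eqP => [->|/eqP ba] //=.
exact: Hg.
Qed.

#[global] Instance ffun_encoding k A `{encoding A} : encoding {ffun 'I_k -> A}.
Proof.
exists (fun f : {ffun 'I_k -> A} => enc [seq f i | i <- enum 'I_k]).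
move=> f g /(@enc_inj (seq A) _) /eq_in_map E.
by apply/ffunP => i; apply: E; rewrite mem_enum.
Defined.

Lemma comp_ffun k X A `{encoding X} `{encoding A} (F : X -> 'I_k -> A) :
  (forall i, computable (fun x => F x i)) -> computable (fun x => [ffun i => F x i]).
Proof.
move=> cF.
have : computable (fun x => [seq F x i | i <- enum 'I_k]).
  by elim: (enum 'I_k) => [|i s IH] /=; comp; exact: cF.
case=> g cg Hg; exists g => // x; rewrite Hg.
by congr enc; apply: eq_map => i; rewrite ffunE.
Qed.

Lemma comp_at k X A `{encoding X} `{encoding A} (F : X -> {ffun 'I_k -> A}) i :
  computable F -> computable (fun x => F x i).
Proof.
have : nat_computable1 (fun z => head_nat (iter i tail_nat z)).
  apply: (nc_head (f := fun s => iter i tail_nat (nth 0%N s 0))).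
  elim: (i : nat) => [|j IH]; first exact: nc_var.
  exact: (nc_tail (f := fun s => iter j tail_nat (nth 0%N s 0))).
move=> cn; apply: (comp_comp (f := fun f : {ffun _} => f i)).
exists (fun z => head_nat (iter i tail_nat z)) => // f.
rewrite -[enc f]/(enc [seq f i | i <- enum 'I_k]).
have -> : enc (f i) = nth (enc (f i)) [seq enc (f j) | j <- enum 'I_k] i.
  by rewrite (nth_map i) ?size_enum_ord // nth_ord_enum.
have : (i < size (enum 'I_k))%N by rewrite size_enum_ord.
elim: (i : nat) (enum 'I_k) => [|j IH] [|a s] //.
- by rewrite /= -/(enc s) cons_natK1.
- by move=> /IH E; rewrite iterSr enc_cons cons_natK2.
Qed.

End Finite.

(** Lets a search over numbers range over [A]: the value [a] is met at the number [enc a]. *)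
Class decoding A `{encoding A} := Decoding {
  dec : nat -> A;
  encK : cancel enc dec;
  comp_dec : computable dec }.
Arguments decoding A {_}.

#[global] Instance nat_decoding : decoding nat.
Proof. by exists id => //; comp. Defined.

#[global] Instance bool_decoding : decoding bool.
Proof. by exists (fun z => z != 0%N) => [[]|] //; comp. Defined.

Lemma comp_dec_app X A `{encoding X} `{encA : encoding A} `{@decoding A encA}
  (f : X -> nat) : computable f -> computable (fun x => dec (f x)).
Proof. exact: comp_comp comp_dec. Qed.

#[global] Instance prod_decoding A B `{encA : encoding A} `{encB : encoding B}
  `{@decoding A encA} `{@decoding B encB} : decoding (A * B).
Proof.
exists (fun z => (dec (head_nat z), dec (tail_nat z))).
  by move=> [a b]; rewrite enc_pair cons_natK1 cons_natK2 !encK.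
by apply: comp_pair; apply: comp_dec_app; comp.
Defined.

#[global] Instance seq_decoding A `{encA : encoding A} `{decA : @decoding A encA} :
  decoding (seq A).
Proof.
pose st (p : nat * seq A) :=
  if p.1 == 0%N then p else (tail_nat p.1, @dec A encA decA (head_nat p.1) :: p.2).
exists (fun z => rev (iter z st (z, [::])).2).
  (* The code 0 of the empty list is a fixed point of [st], so running for [z] rounds, at least the
     length, is enough. *)
  move=> s; suff E n t : (size s <= n)%N -> 
      iter n st (@enc _ (@seq_encoding A encA) s, t) = (0%N, catrev s t).
    by rewrite E ?size_enc //= -[catrev s _]/(rev s) revK.
  elim: n s t => [|n IH] [|a s] t // sn.
    by rewrite iterSr; exact: (IH [::]).
  rewrite iterSr enc_cons (_ : st _ = (@enc _ (@seq_encoding A encA) s, a :: t)).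
    exact: IH.
  by rewrite /st [fst _]/= gtn_eqF ?cons_nat_gt0 // cons_natK1 cons_natK2 encK.
comp; apply: comp_dec_app; comp.
Defined.

#[global] Instance int_decoding : decoding int.
Proof.
exists (fun z => if dec (head_nat z) then Negz (tail_nat z) else Posz (tail_nat z)).
  by move=> [n|n]; rewrite /= cons_natK1 cons_natK2.
apply: comp_if; first by apply: comp_dec_app; comp.
  by apply: comp_Negz; comp.
by apply: comp_Posz; comp.
Defined.

Ltac comp_arith := first
  [ comp_seq | apply: comp_odd | apply: comp_divn | apply: comp_trunc_log2
  | apply: comp_Posz | apply: comp_Negz | apply: comp_intcase
  | apply: comp_at | apply: comp_ffun; intro | apply: comp_dec_app ].

Ltac comp_hook ::= comp_arith.

Arguments dec : simpl never.

(** * From computable functions to machines *)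

Lemma rep_set0 W t e e' a (T : tapes W) b : rep t e T -> rep t e' (act a T) ->
  rep (move_head b.2 (write_head b.1 t)) e' (act (set_action ord0 b a) T).
Proof.
move=> [T0 _] [_ Te']; split; first by rewrite act_set_action eqxx T0.
by move=> i iW; rewrite act_set_action reg0 //; exact: Te'.
Qed.

Lemma rep_eq W t e e' (T : tapes W) : rep t e T -> (forall i, e i = e' i) -> rep t e' T.
Proof. by move=> HT /env_ext <-. Qed.

Section Search.
Variables (f : seq bool * nat -> option (seq bool)) (cf : computable f).

(** Reading pushes the input bits on a list and so reverses them; writing pops bits while moving
    left, so the output is wanted in reverse as well. *)
Let h (x : seq bool * nat) : option (seq bool) :=
  if f (rev x.1, x.2) is Some v then Some (rev v) else None.

Let comp_h : computable h.
Proof. by rewrite /h; comp. Qed.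

Let zero : env := fun=> 0%N.

(** Tape 0 after [j] bits have been read and erased, [w] being still unread. Erasing leaves a blank
    tape for the output. *)
Definition tape_left j (w : seq bool) : tape :=
  if w is b :: w' then Tape (nseq j None) (Some b) (map Some w')
  else Tape (nseq j None) None [::].

(** Register 0 is for the reversed input, 1 for the bit just read and later for the search index, 2
    for the value of [h], and 3 for the bit to be written. *)
Let regs1 a : env := upd zero 0 a.
Let regs2 a b : env := upd (regs1 a) 1 b.
Let regs3 a b c : env := upd (regs2 a b) 2 c.

Lemma exec_read : exists c, forall (b : bool) (u : seq bool),
  exec c (regs2 (enc u) b) (regs1 (enc (b :: u))).
Proof.
have c0 := @nc_var 2 0 erefl; have c1 := @nc_var 2 1 erefl.
have /(_ [:: 0; 1]%N 2%N)[//|//|c Hc] := nc_cons c1 c0.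
exists (Seq c (Seq (clear_reg 0) (Seq (clear_reg 1) (move_reg 2 0)))) => b u.
apply: exec_seq (Hc _ _) (exec_seq (exec_clear _ _) (exec_seq (exec_clear _ _) _)).
  by case=> [|[|]].
by apply: exec_eq (exec_move _ _) _ => // -[|[|[|i]]].
Qed.

Lemma exec_search : exists c, forall u n,
  exec c (regs2 (enc u) n) (regs3 (enc u) n (enc (h (u, n)))).
Proof.
have [g cg Hg] := comp_h.
have c0 := @nc_var 2 0 erefl; have c1 := @nc_var 2 1 erefl.
have /(_ [:: 0; 1]%N 2%N)[//|//|c Hc] := nc_comp1 cg (nc_cons c0 c1).
exists c => u n; apply: exec_eq (Hc _ _) _ => [|i]; first by case=> [|[|]].
by rewrite -Hg.
Qed.

Lemma exec_write : exists c, forall u n (b : bool) (v : seq bool),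
  exec c (regs3 u n (enc (b :: v))) (upd (regs3 u n (enc v)) 3 b).
Proof.
have c0 := @nc_var 1 0 erefl.
have /(_ [:: 2]%N 3%N)[//|//|c Hc] := nc_head c0.
have /(_ [:: 2]%N 4%N)[//|//|d Hd] := nc_tail c0.
exists (Seq c (Seq d (Seq (clear_reg 2) (move_reg 4 2)))) => u n b v.
apply: exec_seq (Hc _ _) (exec_seq (Hd _ _) (exec_seq (exec_clear _ _) _)).
- by case=> [|[|[|]]].
- by case=> [|[|[|[|]]]].
apply: exec_eq (exec_move _ _) _ => // -[|[|[|[|[|i]]]]] //.
- by rewrite /= /upd /= -/(enc v) cons_natK2.
- by rewrite /= /upd /= -/(enc v) cons_natK1.
Qed.

(** The only source of machines below. Being an equivalence, it also says that the machine diverges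
    when there is no value. *)
Theorem search_machine : exists M : machine, forall w v, computes M w v <->
  exists2 n, f (w, n) = Some v & forall m, (m < n)%N -> f (w, m) = None.
Proof.
have [cr Hr] := exec_read; have [cs Hs] := exec_search; have [cw Hw] := exec_write.
pose W := maxn 5 (maxn (width cr) (maxn (width cs) (width cw))).
have [W5 Wr Ws Ww] : [/\ 5 <= W, width cr <= W, width cs <= W & width cw <= W]%N.
  by rewrite /W; split; lia.
(* Marking the work tapes sets every counter to 0. *)
pose init (s : symbols W) : actions W :=
  [ffun i => if i == ord0 then (s i, Stay) else (Some true, Stay)].
pose read (s : symbols W) := set_action ord0 (None, Right)
  (if s ord0 == Some true then inc_action 1 s else stay s).
(* The bit in register 3 is written, and the decrement returns that register to 0. *)
pose write (s : symbols W) := set_action ord0 (Some (~~ zero_test 3 s), Left) (dec_action 3 s).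
pose last (s : symbols W) := set_action ord0 (s ord0, Right) (stay s).
pose reading := cwhile (fun s => s ord0 != None) (cseq (prim read) (compile W cr)).
pose searching := cwhile (zero_test 2) (compile W (Seq (Inc 1) cs)).
pose writing := cwhile (fun s => ~~ zero_test 2 s) (cseq (compile W cw) (prim write)).
(* [Dec 2] turns the code of [Some v] into that of [v]; [last] steps from the blank left of the
   output onto its first bit. *)
pose C := cseq (cseq (prim init) reading) (cseq (compile W cs) (cseq searching
  (cseq (compile W (Dec 2)) (cseq writing (prim last))))).
have readingP j w u T : rep (tape_left j w) (regs1 (enc u)) T ->
    exists2 T', halts reading T T' &
      rep (tape_left (j + size w) [::]) (regs1 (enc (catrev w u))) T'.
  elim: w j u T => [|b w IH] j u T HT.
    exists T; last by rewrite addn0.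
    by apply: halts_while_false; rewrite ffunE HT.1.
  have H1 : rep (tape_left j.+1 w) (regs2 (enc u) b) (act (read (scan T)) T).
    have -> : tape_left j.+1 w = move_head Right (write_head None (tape_left j (b :: w))).
      by case: (w).
    apply: rep_set0 (HT) _; rewrite ffunE HT.1; case: b HT => HT.
      by rewrite eqxx; apply: (rep_eq (rep_inc (i := 1) _ HT)) => [|[|[|]]] //; lia.
    by rewrite (_ : _ == _ = false) // act_stay; apply: (rep_eq HT) => -[|[|]].
  have [T2 h2 /IH[T3 h3 HT3]] := compileP (Hr b u) Wr H1.
  exists T3; last by rewrite addnS -addSn.
  apply: halts_while_true h3; first by rewrite ffunE HT.1.
  exact: halts_seq (halts_prim _ _) h2.
have searchP u n T t : rep t (regs3 (enc u) n (enc (h (u, n)))) T -> h (u, n) = None ->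
    zero_test 2 (scan T) /\ exists2 T', halts (compile W (Seq (Inc 1) cs)) T T' &
      rep t (regs3 (enc u) n.+1 (enc (h (u, n.+1)))) T'.
  move=> HT hN; split; first by rewrite (zero_testE _ HT) ?hN //; lia.
  apply: compileP HT; last by rewrite /=; lia.
  apply: exec_seq (exec_inc _ _) _; have := Hs u n.+1; rewrite hN.
  by congr exec; apply: env_ext => -[|[|[|]]].
have writingP u n v j s T :
    rep (Tape (nseq j None) None (map Some s)) (regs3 u n (enc v)) T ->
    exists2 T', halts writing T T' &
      exists k, rep (Tape (nseq k None) None (map Some (catrev v s))) (regs3 u n 0) T'.
  elim: v j s T => [|b v IH] j s T HT.
    exists T; last by exists j.
    by apply: halts_while_false; rewrite (zero_testE _ HT) //; lia.
  have [T1 h1 HT1] := compileP (Hw u n b v) Ww HT.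
  (* The predecessor of [j] is truncated because the stored blanks on the left may be used up;
     [move_head] then supplies a fresh one. *)
  have H2 : rep (Tape (nseq j.-1 None) None (map Some (b :: s))) (regs3 u n (enc v))
      (act (write (scan T1)) T1).
    have -> : Tape (nseq j.-1 None) None (map Some (b :: s)) =
        move_head Left (write_head (Some b) (Tape (nseq j None) None (map Some s))).
      by case: (j).
    have -> : b = ~~ zero_test 3 (scan T1).
      by rewrite (zero_testE _ HT1) ?updE; [case: (b)|lia].
    apply: rep_set0 (HT1) _.
    by apply: (rep_eq (rep_dec (i := 3) _ HT1)) => [|[|[|[|[|]]]]] //; [lia|case: (b)].
  have [T3 h3 HT3] := IH _ _ _ H2.
  exists T3 => //; apply: halts_while_true h3.
    by rewrite (zero_testE _ HT); [rewrite /regs3 updE enc_cons gtn_eqF ?cons_nat_gt0|lia].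
  exact: halts_seq h1 (halts_prim _ _).
pose T0 w := (start (to_machine C) w).2.
have startP w : exists2 T, halts (cseq (prim init) reading) (T0 w) T &
    rep (tape_left (size w) [::]) (regs1 (enc (rev w))) T.
  have [|T h1 H1] := readingP 0%N w [::] (act (init (scan (T0 w))) (T0 w)).
    split; first by rewrite !ffunE eqxx /=; case: (w).
    move=> i iW; rewrite !ffunE reg0 //=; case: i iW => [|i] _; split => //=; by exists 0%N.
  by exists T => //; apply: halts_seq h1; exact: halts_prim.
exists (to_machine C) => w v.
have hE n : h (rev w, n) = omap rev (f (w, n)) by rewrite /h revK; case: (f _).
have [T1 h1 H1] := startP w.
have {H1} : rep (tape_left (size w) [::]) (regs2 (enc (rev w)) 0) T1.
  by apply: (rep_eq H1) => -[|[|]].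
move=> /(compileP (Hs (rev w) 0%N) Ws)[T2 h2 H2].
(* Without any value, register 2 stays 0 and the search loop never ends. *)
have [[n0 fn0]|fN] := pselect (exists n, f (w, n)); last first.
  have {}fN n : f (w, n) = None.
    by case E: (f _) => [v'|] //; case: fN; exists n; rewrite E.
  split=> [|[n]]; last by rewrite fN.
  move=> cv; exfalso; apply: (diverges_computes _ cv).
  apply: diverges_seq h1 (diverges_seq h2 _).
  have div : diverges searching T2.
    apply: (diverges_while (I := fun n T =>
      rep (tape_left (size w) [::]) (regs3 (enc (rev w)) n (enc (h (rev w, n)))) T)) H2.
    by move=> n T HT; apply: searchP HT _; rewrite hE fN.
  exact: diverges_seql.
have [n fn nmin] := ex_minnP (ex_intro (fun n => f (w, n)) n0 fn0).
have {n0 fn0} fN m : (m < n)%N -> f (w, m) = None.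
  by move=> mn; case E: (f _) => [v'|] //; have := nmin m; rewrite E => /(_ isT); lia.
case fv: (f (w, n)) fn => [v0|] // _.
suff cv0 : computes (to_machine C) w v0.
  split=> [/(computes_inj cv0) <-|[n' fn' n'min]]; first by exists n.
  have [nn'|n'n|nn'] := ltngtP n n'.
  - by have := n'min _ nn'; rewrite fv.
  - by have := fN _ n'n; rewrite fn'.
  - by move: fv; rewrite nn' fn' => -[->].
have [T3 h3 H3] : exists2 T3, halts searching T2 T3 &
    rep (tape_left (size w) [::]) (regs3 (enc (rev w)) n (enc (h (rev w, n)))) T3.
  have H k T : (k <= n)%N ->
      rep (tape_left (size w) [::])
        (regs3 (enc (rev w)) (n - k) (enc (h (rev w, n - k)%N))) T ->
      exists2 T3, halts searching T T3 &
      rep (tape_left (size w) [::]) (regs3 (enc (rev w)) n (enc (h (rev w, n)))) T3.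
    elim: k T => [|k IH] T; first rewrite subn0 => _ HT.
    exists T => //; apply: halts_while_false.
      by rewrite (zero_testE _ HT) ?hE ?fv //; lia.
    move=> kn HT; have [|tT [T' hT' HT']] := searchP _ _ _ _ HT.
      by rewrite hE fN //; lia.
    have nk : ((n - k.+1).+1 = n - k)%N by lia.
    rewrite nk in HT'; have [|T3 h3 H3] := IH _ _ HT'; first lia.
    by exists T3 => //; exact: halts_while_true hT' h3.
  by apply: (H n T2 (leqnn n)); rewrite subnn.
have {H3} H3 : rep (tape_left (size w) [::])
    (regs3 (enc (rev w)) n (enc (rev v0)).+1) T3 by move: H3; rewrite hE fv.
have [|T4 h4 H4] := compileP (exec_dec 2 _) _ H3; first by rewrite /=; lia.
have {}H4 : rep (Tape (nseq (size w) None) None (map Some [::]))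
    (regs3 (enc (rev w)) n (enc (rev v0))) T4.
  by apply: (rep_eq H4) => -[|[|[|]]].
have [T5 h5 [k H5]] := writingP _ _ _ _ _ _ H4.
pose T6 := act (last (scan T5)) T5.
have E : leading_bits (scanned (T6 ord0) :: after (T6 ord0)) = v0.
  have lb s : leading_bits (map Some s) = s by elim: s => //= b s ->.
  have cv : catrev (rev v0) [::] = v0 by rewrite -[LHS]/(rev (rev v0)) revK.
  rewrite act_set_action eqxx ffunE H5.1 /= cv.
  by case: (v0) => [|b v1] //=; rewrite lb.
rewrite -E; apply: halts_computes.
exact: halts_seq h1 (halts_seq h2 (halts_seq h3 (halts_seq h4
  (halts_seq h5 (halts_prim _ _))))).
Qed.

End Search.

(** * Simulating a machine *)

#[global] Instance state_encoding (M : machine) : encoding (state M).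
Proof. by exists (fun q => enum_rank q : nat) => p q /ord_inj /enum_rank_inj. Defined.

#[global] Instance direction_encoding : encoding direction.
Proof.
exists (fun d => match d with Left => 0 | Stay => 1 | Right => 2 end)%N.
by case=> -[].
Defined.

#[global] Instance tape_encoding : encoding tape.
Proof.
exists (fun t => enc (before t, scanned t, after t)).
by move=> [b s a] [b' s' a'] /(@enc_inj (seq symbol * symbol * seq symbol) _) [-> -> ->].
Defined.

#[global] Instance config_encoding M : encoding (config M) := prod_encoding.

Section Simulation.
Context {X : Type} `{encX : encoding X}.

Lemma comp_parts (t : X -> tape) : computable t ->
  computable (fun x => (before (t x), scanned (t x), after (t x))).
Proof. exact: (comp_recode (r := fun t => (before t, scanned t, after t))). Qed.

Lemma comp_before (t : X -> tape) : computable t -> computable (fun x => before (t x)).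
Proof. by move=> /comp_parts/comp_fst/comp_fst. Qed.

Lemma comp_scanned (t : X -> tape) : computable t -> computable (fun x => scanned (t x)).
Proof. by move=> /comp_parts/comp_fst/comp_snd. Qed.

Lemma comp_after (t : X -> tape) : computable t -> computable (fun x => after (t x)).
Proof. by move=> /comp_parts/comp_snd. Qed.

Lemma comp_Tape (b : X -> seq symbol) (s : X -> symbol) (a : X -> seq symbol) :
  computable b -> computable s -> computable a ->
  computable (fun x => Tape (b x) (s x) (a x)).
Proof.
move=> cb cs ca; exact: (comp_recode
  (r := fun p : seq symbol * symbol * seq symbol => Tape p.1.1 p.1.2 p.2)
  _ (comp_pair (comp_pair cb cs) ca)).
Qed.

End Simulation.

Ltac comp_tape := first
  [ apply: comp_before | apply: comp_scanned | apply: comp_after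
  | apply: comp_Tape | comp_arith ].

Ltac comp_hook ::= comp_tape.

Lemma comp_move_head X `{encX : encoding X} (d : X -> direction) (t : X -> tape) :
  computable d -> computable t -> computable (fun x => move_head (d x) (t x)).
Proof.
move=> cd ct; apply: (@computable_ext _ _ _ _ (fun x =>
  if enc (d x) == 0%N then
    (if before (t x) is a :: l then Tape l a (scanned (t x) :: after (t x))
     else Tape [::] None (scanned (t x) :: after (t x)))
  else if enc (d x) == 1%N then t x else
    (if after (t x) is a :: l then Tape (scanned (t x) :: before (t x)) a l
            else Tape (scanned (t x) :: before (t x)) None [::]))).
  by move=> x; case: (d x).
by comp.
Qed.

Lemma comp_machine_step (M : machine) : computable (@step M).
Proof.
have ctr : computable (fun p : state M * {ffun 'I_(work_tapes M).+1 -> symbol} =>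
    transition p.1 p.2) by exact: comp_finite.
pose g (c : config M) (p : state M * {ffun 'I_(work_tapes M).+1 -> symbol * direction}) :
    option (config M) :=
  Some (p.1, [ffun i => move_head (p.2 i).2
    (Tape (before (c.2 i)) (p.2 i).1 (after (c.2 i)))]).
apply: (@computable_ext _ _ _ _ (fun c : config M =>
  if transition c.1 [ffun i => scanned (c.2 i)] is Some p then g c p else None)).
  by move=> c; rewrite /step; case: transition => // -[].
apply: comp_ocase.
- by apply: (comp_app2 ctr); comp.
- by comp.
- by rewrite /g; comp; apply: comp_move_head; comp.
Qed.

Lemma comp_leading_bits X `{encX : encoding X} (s : X -> seq symbol) : computable s ->
  computable (fun x => leading_bits (s x)).
Proof.
move=> cs; apply: (@computable_ext _ _ _ _ (fun x => rev (foldl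
  (fun (p : seq bool * bool) a => if a is Some b then
    (if p.2 then p else (b :: p.1, false)) else (p.1, true)) ([::], false) (s x)).1)).
  move=> x; pose st (p : seq bool * bool) (a : symbol) := if a is Some b then
    (if p.2 then p else (b :: p.1, false)) else (p.1, true).
  have stop l t : foldl st (t, true) l = (t, true) by elim: l => //= -[[]|] l IH.
  suff H l t : rev (foldl st (t, false) l).1 = rev t ++ leading_bits l by rewrite H.
  elim: l t => [|[b|] l IH] t /=; first by rewrite cats0.
    by rewrite IH rev_cons cat_rcons.
  by rewrite stop cats0.
by comp.
Qed.

Lemma comp_start X `{encX : encoding X} (M : machine) (w : X -> seq bool) : computable w ->
  computable (fun x => start M (w x)).
Proof.
by move=> cw; rewrite /start /input_tape; comp.
Qed.

(** A value appears only if the machine halts after exactly [t] steps. As a total function it can be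
    searched, with [t] among the candidates. *)
Definition outcome (M : machine) (w : seq bool) (t : nat) : option (seq bool) :=
  if iter t (obind (@step M)) (Some (start M w)) is Some c then
    if step c is Some _ then None else Some (output c)
  else None.

Lemma outcomeP M w v : computes M w v <-> exists t, outcome M w t = Some v.
Proof.
split=> [[t [c [rt ct <-]]]|[t]]; first by exists t; rewrite /outcome rt ct.
rewrite /outcome; case rt: (iter t _ _) => [c|] //.
by case ct: (step c) => [c'|] // [<-]; exists t, c.
Qed.

Lemma comp_outcome X `{encX : encoding X} (M : machine) (w : X -> seq bool) (t : X -> nat) :
  computable w -> computable t -> computable (fun x => outcome M (w x) (t x)).
Proof.
move=> cw ct; rewrite /outcome /obind /oapp.
have cs := comp_machine_step M.
apply: comp_ocase; last by rewrite /output; comp; apply: comp_leading_bits; comp.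
  by comp; apply: comp_start; comp.
by comp.
Qed.

(** * Codes of rational points *)

Definition bits_value (s : seq bool) : nat := foldr (fun (b : bool) a => b + a.*2)%N 0%N s.

Lemma bitsK : cancel bits bits_value.
Proof.
move=> k; have : (k < 2 ^ (trunc_log 2 k).+1)%N by apply: trunc_log_ltn.
rewrite /bits.
move: (trunc_log 2 k).+1 => m; elim: m k => [|m IH] k km.
  by rewrite expn0 ltnS leqn0 in km; rewrite (eqP km).
rewrite /mkseq /= divn1 -[in iota 1 m](addn0 1) iotaDl -map_comp.
rewrite -[RHS]odd_double_half -divn2 -(IH (k %/ 2)%N).
  by congr (_ + (bits_value _).*2)%N; apply: eq_map => i /=; rewrite -divnMA expnS.
by rewrite ltn_divLR // -expnSr.
Qed.

(** The end mark 01 differs from every doubled bit, so its first aligned occurrence ends the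
    code. *)
Lemma doubled_cat (s s' u u' : seq bool) :
  flatten [seq [:: b; b] | b <- s] ++ [:: false, true & u] =
  flatten [seq [:: b; b] | b <- s'] ++ [:: false, true & u'] -> s = s' /\ u = u'.
Proof.
elim: s s' => [|b s IH] [|b' s'] /=.
- by case=> ->.
- by case: b' => -[].
- by case: b => -[].
- by case=> -> _ /IH[-> ->].
Qed.

Lemma nat_code_cat k k' u u' : nat_code k ++ u = nat_code k' ++ u' ->
  k = k' /\ u = u'.
Proof.
rewrite /nat_code -(catA _ _ u) -(catA _ _ u').
by move=> /doubled_cat[/(can_inj bitsK) -> ->].
Qed.

Lemma size_nat_code k : size (nat_code k) = (2 * trunc_log 2 k + 4)%N.
Proof.
have E s : size (flatten [seq [:: b; b] | b <- s]) = (2 * size s)%N.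
  by elim: s => //= b s ->; lia.
by rewrite size_cat E size_mkseq /=; lia.
Qed.

Lemma int_code_cat z z' u u' : int_code z ++ u = int_code z' ++ u' ->
  z = z' /\ u = u'.
Proof.
rewrite /int_code !cat_cons => /eqP.
rewrite eqseq_cons => /andP[/eqP E /eqP/nat_code_cat[Ez ->]]; split=> //.
by move: E Ez; case: z => m; case: z' => m' //= _; lia.
Qed.

(** Rational vectors as machines see them: numerators and denominators, not necessarily in lowest
    terms; [valid_raw] recognises the canonical ones. *)
Definition raw_vector := seq (int * int).

Definition raw_code (v : raw_vector) : seq bool :=
  flatten [seq int_code p.1 ++ int_code p.2 | p <- v].

Definition raw_list_code (s : seq raw_vector) : seq bool :=
  nat_code (size s) ++ flatten [seq raw_code v | v <- s].

Lemma raw_code_cons p v u :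
  raw_code (p :: v) ++ u = int_code p.1 ++ (int_code p.2 ++ (raw_code v ++ u)).
Proof.
rewrite -[raw_code _]/((int_code p.1 ++ int_code p.2) ++ raw_code v).
by rewrite -(catA _ (raw_code v) u) -(catA (int_code p.1) (int_code p.2)).
Qed.

Lemma raw_code_cat v v' u u' : size v = size v' ->
  raw_code v ++ u = raw_code v' ++ u' -> v = v' /\ u = u'.
Proof.
elim: v v' => [|[a b] v IH] [|[a' b'] v'] // [/IH{}IH].
by rewrite !raw_code_cons => /int_code_cat[/= -> /int_code_cat[-> /IH[-> ->]]].
Qed.

(** The code of a vector does not record its dimension; decoding is unique because all dimensions
    equal [n]. *)
Lemma raw_list_code_cat n s s' u u' :
  all (fun v => size v == n) s -> all (fun v => size v == n) s' ->
  raw_list_code s ++ u = raw_list_code s' ++ u' -> s = s' /\ u = u'.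
Proof.
rewrite /raw_list_code -(catA (nat_code _) _ u) -(catA (nat_code _) _ u').
move=> sn s'n /nat_code_cat[].
elim: s s' sn s'n => [|v s IH] [|v' s'] //= /andP[/eqP vn sn] /andP[/eqP v'n s'n] [sz].
rewrite -(catA (raw_code v) _ u) -(catA (raw_code v') _ u').
by move=> /raw_code_cat[|-> /IH[]// -> ->] //; rewrite vn.
Qed.

Definition raw n (q : 'rV[rat]_n) : raw_vector :=
  [seq (numq (q 0%R i), denq (q 0%R i)) | i <- enum 'I_n].

Lemma size_raw n (q : 'rV[rat]_n) : size (raw q) = n.
Proof. by rewrite size_map size_enum_ord. Qed.

Lemma all_size_raw n (s : seq 'rV[rat]_n) :
  all (fun v => size v == n) (map (@raw n) s).
Proof. by apply/allP => v /mapP[q _ ->]; rewrite size_raw. Qed.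

Lemma vec_codeE n (q : 'rV[rat]_n) : vec_code q = raw_code (raw q).
Proof. by rewrite /raw_code -map_comp. Qed.

Lemma list_codeE n (s : seq 'rV[rat]_n) : list_code s = raw_list_code (map (@raw n) s).
Proof.
rewrite /list_code /raw_list_code size_map -map_comp.
by congr (_ ++ flatten _); apply: eq_map => q /=; exact: vec_codeE.
Qed.

Lemma raw_inj n : injective (@raw n).
Proof.
move=> q q' /eq_in_map E; apply/rowP => i.
have [e1 e2] := E i (mem_enum _ _).
by rewrite -(divq_num_den (q 0 i)%R) -(divq_num_den (q' 0 i)%R) e1 e2.
Qed.

Lemma vec_code_inj n : injective (@vec_code n).
Proof.
move=> q q'; rewrite !vec_codeE -(cats0 (raw_code _)) -[RHS](cats0 (raw_code _)).
by move=> /raw_code_cat[|/raw_inj -> _] //; rewrite !size_raw.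
Qed.

Definition valid_raw n (v : raw_vector) : bool :=
  (size v == n) && all (fun p => (0 < p.2)%R && coprime `|p.1| `|p.2|) v.

Lemma valid_rawP n v : reflect (exists q : 'rV[rat]_n, v = raw q) (valid_raw n v).
Proof.
apply: (iffP andP) => [[/eqP vn /allP cp]|[q ->]]; last first.
  rewrite size_raw eqxx; split=> //; apply/allP => _ /mapP[i _ ->] /=.
  by rewrite denq_gt0 coprime_num_den.
exists (\row_i ((nth (0, 0) v i).1%:~R / (nth (0, 0) v i).2%:~R))%R.
apply: (@eq_from_nth _ (0, 0)%R) => [|j]; first by rewrite size_raw.
rewrite vn => jn; pose i := Ordinal jn.
rewrite /raw (nth_map i) ?size_enum_ord // (@nth_ord_enum n i i) mxE /=.
have /andP[d0 cop] := cp _ (mem_nth (0, 0)%R (s := v) (n := j) (eq_ind_r (fun m => j < m)%N jn vn)).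
by rewrite coprimeq_num // coprimeq_den // gtr0_sg // mul1r gtr0_norm // gt_eqF //;
  case: nth.
Qed.

Section ComputableCodes.
Context {X : Type} `{encX : encoding X}.

Lemma comp_nat_code (f : X -> nat) : computable f -> computable (fun x => nat_code (f x)).
Proof.
move=> cf; apply: (@computable_ext _ _ _ _ (fun x => flatten [seq [:: b; b] | b <-
    mkseq (fun i => odd (f x %/ 2 ^ i)) (trunc_log 2 (f x)).+1] ++ [:: false; true])) => //.
by comp.
Qed.

Lemma comp_absz (z : X -> int) : computable z -> computable (fun x => `|z x|%N).
Proof.
move=> cz; apply: (@computable_ext _ _ _ _ (fun x =>
  match z x with Posz n => n | Negz n => n.+1 end)) => [x|]; last by comp.
by case: (z x) => [n|n] //; rewrite NegzE abszN absz_nat.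
Qed.

Lemma comp_ltz0 (z : X -> int) : computable z -> computable (fun x => z x < 0)%R.
Proof.
move=> cz; apply: (@computable_ext _ _ _ _ (fun x =>
  match z x with Posz n => false | Negz n => true end)) => [x|]; last by comp.
by case: (z x) => [n|n].
Qed.

Lemma comp_gtz0 (z : X -> int) : computable z -> computable (fun x => 0 < z x)%R.
Proof.
move=> cz; apply: (@computable_ext _ _ _ _ (fun x =>
  match z x with Posz n => (n != 0%N) | Negz n => false end)) => [x|]; last by comp.
by case: (z x) => [n|n] //; rewrite ltz_nat lt0n.
Qed.

End ComputableCodes.

Ltac comp_hook ::= first
  [ apply: comp_nat_code | apply: comp_absz | apply: comp_ltz0 | apply: comp_gtz0
  | apply: comp_outcome | comp_tape ].

Lemma comp_int_code X `{encX : encoding X} (z : X -> int) : computable z ->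
  computable (fun x => int_code (z x)).
Proof. by move=> cz; rewrite /int_code; comp. Qed.

Ltac comp_numbers := first
  [ apply: comp_int_code | apply: comp_nat_code | apply: comp_absz | apply: comp_ltz0
  | apply: comp_gtz0 | apply: comp_outcome | comp_tape ].

Ltac comp_hook ::= comp_numbers.

Section ComputableRawCodes.
Context {X : Type} `{encX : encoding X}.

Lemma comp_raw_code (v : X -> raw_vector) : computable v ->
  computable (fun x => raw_code (v x)).
Proof. by move=> cv; rewrite /raw_code; comp. Qed.

Lemma comp_raw_list_code (s : X -> seq raw_vector) : computable s ->
  computable (fun x => raw_list_code (s x)).
Proof. by move=> cs; rewrite /raw_list_code; comp; apply: comp_raw_code; comp. Qed.

Lemma comp_gcdn (f g : X -> nat) : computable f -> computable g ->
  computable (fun x => gcdn (f x) (g x)).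
Proof.
move=> cf cg.
pose st (p : nat * nat) := (if p.1 == 0 then p else (p.2 - p.2 %/ p.1 * p.1, p.1))%N.
apply: (@computable_ext _ _ _ _ (fun x => (iter (f x) st (f x, g x)).2)); last by comp.
have H n a m : (a <= n)%N -> (iter n st (a, m)).2 = gcdn a m.
  elim: n a m => [|n IH] a m; first by rewrite leqn0 => /eqP ->; rewrite gcd0n.
  rewrite iterSr {2}/st [fst _]/= [snd _]/=; case: eqP => [->|/eqP a0] an; first exact: IH.
  have -> : (m - m %/ a * a = m %% a)%N by rewrite [in X in (X - _)%N](divn_eq m a) addKn.
  rewrite IH; first by rewrite gcdn_modl gcdnC.
  by rewrite -ltnS (leq_trans _ an) // ltn_mod lt0n.
by move=> x; exact: H.
Qed.

End ComputableRawCodes.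

Lemma comp_valid_raw X `{encX : encoding X} n (v : X -> raw_vector) : computable v ->
  computable (fun x => valid_raw n (v x)).
Proof.
move=> cv; rewrite /valid_raw; comp; rewrite /coprime; comp; apply: comp_gcdn; comp.
Qed.

Ltac comp_codes := first
  [ apply: comp_valid_raw | apply: comp_raw_code | apply: comp_raw_list_code
  | comp_numbers ].

Ltac comp_hook ::= comp_codes.

(** * Approximating the shortest programs *)

(** Each number [j] stands for a program and a running time. The least length found so far decreases
    with [t] to the least complexity of an element of [codes]. *)
Definition shortest (U : machine) (codes : seq (seq bool)) (t : nat) : option nat :=
  iteri t (fun j acc =>
    if outcome U (dec (A := seq bool * nat) j).1 (dec (A := seq bool * nat) j).2 is Some v then
      if has (fun c => v == c) codes then
        (if acc is Some a then
           (if (a <= size (dec (A := seq bool * nat) j).1)%N then Some a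
            else Some (size (dec (A := seq bool * nat) j).1))
         else Some (size (dec (A := seq bool * nat) j).1))
      else acc
    else acc) None.

Lemma comp_shortest X `{encX : encoding X} U (codes : X -> seq (seq bool)) (t : X -> nat) :
  computable codes -> computable t -> computable (fun x => shortest U (codes x) (t x)).
Proof. by move=> cc ct; rewrite /shortest; comp. Qed.

Ltac comp_hook ::= first [ apply: comp_shortest | comp_codes ].

(** Makes the approximation independent of the list that presents a finite set. *)
Lemma eq_shortest U codes codes' : codes =i codes' -> shortest U codes =1 shortest U codes'.
Proof.
move=> cc t; rewrite /shortest; congr iteri; apply: funext => j; apply: funext => acc.
case: outcome => // v.
by rewrite (eq_has (a2 := pred1 v)) ?has_pred1 ?cc -?has_pred1 //;
  congr (if _ then _ else _); apply: eq_has => c /=; rewrite eq_sym.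
Qed.

Definition listed U (codes : seq (seq bool)) (j : nat) (p : seq bool) : Prop :=
  exists t v, [/\ dec (A := seq bool * nat) j = (p, t), outcome U p t = Some v & v \in codes].

Lemma shortestP U codes t :
  (forall a, shortest U codes t = Some a ->
     exists j p, [/\ (j < t)%N, listed U codes j p & a = size p]) /\
  (forall j p, (j < t)%N -> listed U codes j p ->
     exists2 a, shortest U codes t = Some a & (a <= size p)%N).
Proof.
rewrite /shortest; elim: t => [|t [IH1 IH2]]; first by split.
rewrite iteriS; move: (iteri t _ _) IH1 IH2 => acc IH1 IH2.
case E : (dec (A := seq bool * nat) t) => [p u]; cbn [fst snd].
have upd : (if outcome U p u is Some v then v \in codes else false) <->
    listed U codes t p.
  split=> [|[u' [v []]]]; last by rewrite E => -[<-] -> ->.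
  by case oE: outcome => [v|] // vc; exists u, v.
have IH1' a : acc = Some a -> exists j p, [/\ (j < t.+1)%N, listed U codes j p & a = size p].
  by move=> /IH1[j [q [jt lj aq]]]; exists j, q; split=> //; exact: ltnW.
have noupd : ~ listed U codes t p -> (forall a, acc = Some a ->
     exists j p, [/\ (j < t.+1)%N, listed U codes j p & a = size p]) /\
    (forall j p, (j < t.+1)%N -> listed U codes j p ->
     exists2 a, acc = Some a & (a <= size p)%N).
  move=> np; split=> // j q; rewrite ltnS leq_eqVlt => /predU1P[->|]; last exact: IH2.
  by case=> [u' [v []]]; rewrite E => -[<- <-] ov vc; case: np; exists u, v.
case oE: outcome upd => [v|] upd; last by apply: noupd => /upd.
have -> : has (fun c => v == c) codes = (v \in codes).
  by rewrite -has_pred1; apply: eq_has => c /=; rewrite eq_sym.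
case: ifP upd => [vc [/(_ isT) lt _]|vc upd]; last by apply: noupd => /upd.
have ltq q : listed U codes t q -> q = p by case=> [u' [v' []]]; rewrite E => -[<-].
case: acc IH1 IH2 IH1' {noupd} => [a|] IH1 IH2 IH1'; last first.
  split=> [_ [<-]|j q]; first by exists t, p.
  rewrite ltnS leq_eqVlt => /predU1P[->/ltq ->|jt /(IH2 _ _ jt)[]//].
  by exists (size p).
case: leqP => ap; split=> [b ba|j q].
- exact: IH1'.
- rewrite ltnS leq_eqVlt => /predU1P[->/ltq ->|jt /(IH2 _ _ jt)//].
  by exists a.
- by exists t, p; case: ba => <-.
- rewrite ltnS leq_eqVlt => /predU1P[->/ltq ->|jt /(IH2 _ _ jt)[_ [<-] aq]].
    by exists (size p).
  by exists (size p) => //; rewrite (leq_trans (ltnW ap)).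
Qed.

(** [None] plays the part of infinite complexity. *)
Definition inverse_power (o : option nat) : rat :=
  if o is Some a then (2 ^- a)%R else 0%R.

Definition inverse_power_code (o : option nat) : seq bool :=
  if o is Some a then int_code 1 ++ int_code (Posz (2 ^ a)) else int_code 0 ++ int_code 1.

Lemma rat_code_inverse_power o : rat_code (inverse_power o) = inverse_power_code o.
Proof.
case: o => [a|] //=; rewrite /rat_code.
have -> : (2 ^- a = 1%:Z%:Q / (Posz (2 ^ a))%:Q)%R by rewrite mul1r -pmulrn natrX.
have a0 : (Posz (2 ^ a) != 0)%R by rewrite -lt0n expn_gt0.
rewrite coprimeq_num ?coprimeq_den //= ?(negbTE a0) ?coprime1n //.
by rewrite gtr0_sg ?mul1r // ltz_nat expn_gt0.
Qed.

Definition nu_hat U n (A : {fset 'rV[rat]_n}) (t : nat) : rat :=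
  inverse_power (shortest U [seq vec_code q | q <- A] t).

(* No parser is needed: the input is compared with the codes of all lists. *)
Definition nu_hat_search U n (x : seq bool * nat) : option (seq bool) :=
  if (x.1 == raw_list_code (dec (A := seq raw_vector * nat) x.2).1 ++
             nat_code (dec (A := seq raw_vector * nat) x.2).2) &&
     all (fun v => size v == n) (dec (A := seq raw_vector * nat) x.2).1
  then Some (inverse_power_code (shortest U
    (map raw_code (dec (A := seq raw_vector * nat) x.2).1)
    (dec (A := seq raw_vector * nat) x.2).2))
  else None.

(** By unique decoding every successful candidate yields the right value, hence so does the least
    one. *)
Theorem computable_nu_hat U n : computable_set_function (@nu_hat U n).
Proof.
pose f := nu_hat_search U n.
have cf : computable f.
  by rewrite /f /nu_hat_search /inverse_power_code; comp.
have [M HM] := search_machine cf; exists M => s t.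
set w := _ ++ _.
have fE T v : f (w, T) = Some v -> v = rat_code (nu_hat U [fset q in s]%fset t).
  rewrite /f /nu_hat_search; case: (dec (A := seq raw_vector * nat) T) => s' t' /=.
  case: ifP => // /andP[/eqP + s'n] [<-].
  rewrite /w list_codeE => /(raw_list_code_cat (all_size_raw s) s'n)[<-].
  rewrite -(cats0 (nat_code t)) -[in RHS](cats0 (nat_code t')) => /nat_code_cat[-> _].
  rewrite /nu_hat rat_code_inverse_power; congr inverse_power_code.
  apply: eq_shortest => c; rewrite -map_comp; apply/mapP/mapP => -[q].
    by move=> qs ->; exists q; rewrite ?inE ?vec_codeE.
  by rewrite inE => qs ->; exists q; rewrite ?vec_codeE.
have [T0 fT0] : exists T, f (w, T).
  exists (enc (A := seq raw_vector * nat) (map (@raw n) s, t)).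
  rewrite /f /nu_hat_search; cbn [fst snd]; rewrite (encK (A := seq raw_vector * nat)).
  by rewrite -list_codeE eqxx all_size_raw.
have [T fT' Tmin] := ex_minnP (ex_intro (fun T => f (w, T)) _ fT0).
apply/HM; exists T; first by case E: (f _) fT' => [v|] // _; rewrite (fE _ _ E).
by move=> m mT; case E: (f _) => [v|] //; have := Tmin m; rewrite E => /(_ isT); lia.
Qed.

(** * Enumerating cubes of large measure *)

(** The domain is a single string. By universality every string then has a program, so the
    complexity is a genuine minimum. *)
Lemma constant_machine w : exists2 M : machine, prefix_machine M & computes M [::] w.
Proof.
pose f (x : seq bool * nat) : option (seq bool) := if x.1 == [::] then Some w else None.
have cf : computable f by rewrite /f; comp.
have [M HM] := search_machine cf; exists M; last by apply/HM; exists 0%N.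
move=> u v [u' /HM[m + _]] [v' /HM[m' + _]] _; rewrite /f /=.
by do 2 case: eqP => // ->.
Qed.

(** The floor of 2^r times the fraction [p]. For a negative numerator -k over d, the floor of -k/d
    is [Negz] of the quotient of k - 1 by d. *)
Definition scaled_floor (r : nat) (p : int * int) : int :=
  match p.1 with
  | Posz m => Posz ((2 ^ r * m) %/ `|p.2|)
  | Negz m => Negz ((2 ^ r * m.+1).-1 %/ `|p.2|)
  end.

Lemma scaled_floorE r p : (0 < p.2)%R ->
  scaled_floor r p = (Posz (2 ^ r) * p.1 %/ p.2)%Z.
Proof.
case: p => -[m|m] [[|d]|d] //= _; rewrite /scaled_floor /=.
  by rewrite -PoszM divz_nat.
have -> : (Posz (2 ^ r) * Negz m = Negz (2 ^ r * m.+1).-1)%R.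
  by rewrite !NegzE prednK ?muln_gt0 ?expn_gt0 // PoszM mulrN.
by rewrite divNz_nat // NegzE.
Qed.

Definition cube_key (r : nat) (v : raw_vector) : seq int := [seq scaled_floor r p | p <- v].

Lemma comp_cube_key X `{encX : encoding X} (r : X -> nat) (v : X -> raw_vector) :
  computable r -> computable v -> computable (fun x => cube_key (r x) (v x)).
Proof. by move=> cr cv; rewrite /cube_key /scaled_floor; comp. Qed.

Ltac comp_hook ::= first [ apply: comp_cube_key | comp_codes ].

(* A guess: a list of rational points, an approximation stage, a running time
   of the machine and its output. *)
Definition guess : Type := (seq raw_vector * nat) * (nat * (int * int)).

(** A decidable certificate that some cube of side 2^-r has measure above 2^-k. The last two tests
    say that the fraction output by [M] exceeds 2^-k, cleared of denominators. *)
Definition correct_guess (M : machine) (n r k : nat) (g : guess) : bool :=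
  [&& g.1.1 != [::], all (valid_raw n) g.1.1,
      all (fun v => cube_key r v == cube_key r (head [::] g.1.1)) g.1.1,
      outcome M (raw_list_code g.1.1 ++ nat_code g.1.2) g.2.1 ==
        Some (int_code g.2.2.1 ++ int_code g.2.2.2),
      (0 < g.2.2.1)%R & (`|g.2.2.2| < `|g.2.2.1| * 2 ^ k)%N].

Definition new_cube r (s : seq raw_vector) (v : raw_vector) : bool :=
  all (fun u => cube_key r u != cube_key r v) s.

(* Representatives of the cubes discovered by the first [N] guesses. *)
Definition cube_reps (M : machine) (n r k N : nat) : seq raw_vector :=
  iteri N (fun j s =>
    if correct_guess M n r k (dec (A := guess) j) &&
       new_cube r s (head [::] (dec (A := guess) j).1.1)
    then s ++ [:: head [::] (dec (A := guess) j).1.1] else s) [::].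

Lemma cube_repsS M n r k N : cube_reps M n r k N.+1 =
  cube_reps M n r k N ++
    (if correct_guess M n r k (dec (A := guess) N) &&
       new_cube r (cube_reps M n r k N) (head [::] (dec (A := guess) N).1.1)
     then [:: head [::] (dec (A := guess) N).1.1] else [::]).
Proof. by rewrite {1}/cube_reps iteriS; case: ifP; rewrite ?cats0. Qed.

(** Since the enumeration only appends, the place of a cube does not depend on how long one
    waits. *)
Lemma cube_reps_prefix M n r k N N' : (N <= N')%N ->
  prefix (cube_reps M n r k N) (cube_reps M n r k N').
Proof.
move=> /subnKC <-; elim: (N' - N)%N => [|m IH]; first by rewrite addn0 prefix_refl.
by rewrite addnS cube_repsS; apply: prefix_trans IH (prefix_prefix _ _).
Qed.

Lemma comp_head_seq X A `{encX : encoding X} `{encA : encoding A} (d : A) (s : X -> seq A) :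
  computable s -> computable (fun x => head d (s x)).
Proof.
move=> cs; apply: (@computable_ext _ _ _ _ (fun x => if s x is a :: _ then a else d)).
  by move=> x; case: (s x).
by comp.
Qed.

Lemma comp_cube_reps X `{encX : encoding X} M n (r k N : X -> nat) :
  computable r -> computable k -> computable N ->
  computable (fun x => cube_reps M n (r x) (k x) (N x)).
Proof.
move=> cr ck cN; rewrite /cube_reps /correct_guess /new_cube.
comp; apply: comp_head_seq; comp.
Qed.

Definition string_value (u : seq bool) : nat := foldl (fun a (b : bool) => b + a.*2)%N 0%N u.

Lemma string_value_onto m i : (i < 2 ^ m)%N -> exists2 u, size u = m & string_value u = i.
Proof.
elim: m i => [|m IH] i; first by rewrite expn0 ltnS leqn0 => /eqP ->; exists [::].
move=> im; have [|u um ui] := IH i./2; first by rewrite -divn2 ltn_divLR // -expnSr.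
exists (rcons u (odd i)); first by rewrite size_rcons um.
by rewrite /string_value foldl_rcons -/(string_value u) ui odd_double_half.
Qed.

(** Once [r] and [k] are read, the number of bits to follow is known; this makes the domain
    prefix-free. The last component is a waiting time, found by the search and absent from the
    input. *)
Definition cube_search M n c (x : seq bool * nat) : option (seq bool) :=
  let y := dec (A := (nat * nat) * (seq bool * nat)) x.2 in
  if (x.1 == nat_code y.1.1 ++ (nat_code y.1.2 ++ y.2.1)) &&
     (size y.2.1 == y.1.2 + c)%N &&
     (string_value y.2.1 < size (cube_reps M n y.1.1 y.1.2 y.2.2))%N
  then Some (raw_code (nth [::] (cube_reps M n y.1.1 y.1.2 y.2.2) (string_value y.2.1)))
  else None.

Ltac comp_hook ::= first [ apply: comp_cube_reps | comp_codes ].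

Lemma comp_cube_search M n c : computable (cube_search M n c).
Proof.
rewrite /cube_search /string_value; cbv zeta.
have cdouble X (eX : encoding X) (f : X -> nat) : computable f ->
    computable (fun x => (f x).*2).
  move=> cf; apply: (@computable_ext _ _ _ _ (fun x => f x + f x)%N); last by comp.
  by move=> x; rewrite addnn.
by comp; apply: cdouble; comp.
Qed.

(* A cube is described by its scale, its measure and its place in the
   enumeration of the cubes of that scale and measure. *)
Theorem cube_machine M n c : exists2 M' : machine, prefix_machine M' &
  forall r k N v, v \in cube_reps M n r k N -> (size (cube_reps M n r k N) <= 2 ^ (k + c))%N ->
  exists2 p, computes M' p (raw_code v) &
    size p = (size (nat_code r) + size (nat_code k) + (k + c))%N.
Proof.
have [M' HM'] := search_machine (comp_cube_search M n c); exists M'.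
  have dom p w : computes M' p w -> exists r k u,
      p = nat_code r ++ (nat_code k ++ u) /\ size u = (k + c)%N.
    move=> /HM'[m + _]; rewrite /cube_search; case: (dec _) => [[r k] [u N]]; cbn [fst snd].
    by case: ifP => // /andP[/andP[/eqP -> /eqP sz] _] _; exists r, k, u.
  move=> p q [w /dom[r [k [u [-> szu]]]]] [w' /dom[r' [k' [u' [-> szu']]]]].
  move=> /prefixP[t]; rewrite -(catA (nat_code r)) -(catA (nat_code k)).
  move=> /nat_code_cat[<- /nat_code_cat[kk E]]; rewrite {}kk in szu' E *.
  (* Both remainders have length k + c, so the extension [t] is empty. *)
  have : size u' = size (u ++ t) by rewrite E.
  rewrite size_cat szu szu' => /eqP; rewrite -{1}[(k + c)%N]addn0 eqn_add2l eq_sym.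
  by rewrite size_eq0 => /eqP t0; rewrite E t0 cats0.
move=> r k N v vN sN.
have iN := vN; rewrite -index_mem in iN.
have [u uk ui] := string_value_onto (leq_trans iN sN).
pose p := nat_code r ++ (nat_code k ++ u); exists p; last first.
  by rewrite !size_cat uk addnA.
pose f := cube_search M n c.
have fE T w : f (p, T) = Some w -> w = raw_code v.
  rewrite /f /cube_search; case: (dec _) => [[r' k'] [u' N']]; cbn [fst snd].
  case: ifP => // /andP[/andP[/eqP + _]].
  move=> /nat_code_cat[<- /nat_code_cat[<- <-]]; rewrite ui => iN' [<-]; congr raw_code.
  (* The waiting time found may differ from [N], but one list is a prefix of the other and the index
     lies in both. *)
  have [NN'|/ltnW NN'] := leqP N N'; have /prefixP[t E] := cube_reps_prefix M n r k NN'.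
    by rewrite E nth_cat iN nth_index.
  by move: iN' (nth_index [::] vN); move: (index _ _) => i iN'; rewrite E nth_cat iN'.
have [T0 fT0] : exists T, f (p, T).
  exists (enc (A := (nat * nat) * (seq bool * nat)) ((r, k), (u, N))).
  rewrite /f /cube_search; cbn [fst snd].
  rewrite (encK (A := (nat * nat) * (seq bool * nat))); cbn [fst snd].
  by rewrite eqxx uk eqxx ui iN.
have [T fT' Tmin] := ex_minnP (ex_intro (fun T => f (p, T)) _ fT0).
apply/HM'; exists T; first by rewrite -/f; case E: (f _) fT' => [w|] // _; rewrite (fE _ _ E).
by move=> m mT; rewrite -/f; case E: (f _) => [w|] //; have := Tmin m; rewrite E => /(_ isT); lia.
Qed.

(** * The outer measure of the universal machine *)

Local Open Scope classical_set_scope.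
Local Open Scope ring_scope.

Lemma min_natP (A : set nat) : A !=set0 ->
  A (min_nat A) /\ forall k, A k -> (min_nat A <= k)%N.
Proof.
move=> [k Ak]; rewrite /min_nat; case: pselect => [exA|]; last first.
  by case; exists k; exact/asboolP.
by case: ex_minnP => m /asboolP Am mmin; split=> // l /asboolP; exact: mmin.
Qed.

Section Complexity.
Variables (U : machine) (hU : universal_prefix_machine U).

Lemma complexityP w : (exists2 p, computes U p w & size p = complexity U w) /\
  forall p, computes U p w -> (complexity U w <= size p)%N.
Proof.
have [M pM Mw] := constant_machine w.
have [c /(_ _ _ Mw)[p pw _]] := hU.2 M pM.
have [|[q /= qw qs] cmin] := @min_natP [set size p | p in [set p | computes U p w]].
  by exists (size p), p.
by split=> [|q' q'w]; [exists q|apply: cmin; exists q'].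
Qed.

End Complexity.

(** * Kraft's inequality *)

Lemma prefix_total (p q t : seq bool) : prefix p t -> prefix q t ->
  prefix p q \/ prefix q p.
Proof.
elim: t p q => [|b t IH] [|a p] [|c q] //=; try by [left | right].
move=> /andP[/eqP -> pt] /andP[/eqP -> qt].
by case: (IH _ _ pt qt) => h; [left|right]; rewrite eqxx.
Qed.

(** Among the strings of length N, 2^(N-|p|) extend p, and none extends two elements of a
    prefix-free set. Count the pairs in both orders. *)
Lemma kraft_nat (s : seq (seq bool)) N : uniq s ->
  (forall p q, p \in s -> q \in s -> prefix p q -> p = q) ->
  (forall p, p \in s -> (size p <= N)%N) ->
  (\sum_(p <- s) 2 ^ (N - size p) <= 2 ^ N)%N.
Proof.
move=> us pf sN.
have ext p : p \in s -> (2 ^ (N - size p) <= \sum_(t : N.-tuple bool) prefix p t)%N.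
  move=> ps; rewrite -big_mkcond sum1_card.
  pose f (u : (N - size p).-tuple bool) : N.-tuple bool :=
    tcast (subnKC (sN p ps)) [tuple of in_tuple p ++ u].
  have fE u : f u = p ++ u :> seq bool by rewrite val_tcast.
  have finj : injective f.
    move=> u v /(congr1 val); rewrite /= !fE => /eqP.
    by rewrite eqseq_cat // eqxx => /eqP/val_inj.
  have <- : #|codom f| = (2 ^ (N - size p))%N.
    by rewrite card_codom // card_tuple card_bool.
  apply/subset_leq_card/fintype.subsetP => _ /codomP[u ->].
  by rewrite unfold_in fE prefix_prefix.
apply: (@leq_trans (\sum_(p <- s) \sum_(t : N.-tuple bool) prefix p t)%N).
  by rewrite big_seq [X in (_ <= X)%N]big_seq; exact: leq_sum.
rewrite exchange_big /=.
have -> : (2 ^ N = \sum_(t : N.-tuple bool) 1)%N by rewrite sum1_card card_tuple card_bool.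
apply: leq_sum => t _; rewrite -big_mkcond sum1_count -size_filter.
set l := seq.filter _ _; have ul : uniq l by exact: filter_uniq.
have ll p q : p \in l -> q \in l -> p = q.
  rewrite !mem_filter => /andP[pt ps] /andP[qt qs].
  by case: (prefix_total pt qt) => h; [exact: pf|apply/esym/pf].
case: l ul ll => [|p [|q l]] //= /andP[+ _] /(_ p q); rewrite !inE !eqxx orbT.
by move=> + /(_ isT isT) E; rewrite E eqxx.
Qed.

Lemma kraft (R : numFieldType) (s : seq (seq bool)) : uniq s ->
  (forall p q, p \in s -> q \in s -> prefix p q -> p = q) ->
  \sum_(p <- s) 2 ^- size p <= 1 :> R.
Proof.
move=> us pf; pose N := (\max_(p <- s) size p)%N.
have sN p : p \in s -> (size p <= N)%N by move=> ps; exact: leq_bigmax_seq.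
have N0 : 0 < 2 ^+ N :> R by rewrite exprn_gt0.
have := kraft_nat us pf sN; rewrite -(ler_nat R) natrX natr_sum => le1.
rewrite -(ler_pM2r N0) mul1r mulr_suml; apply: le_trans le1.
rewrite big_seq [X in _ <= X]big_seq; apply: ler_sum => p ps.
by rewrite natrX exprB ?sN // ?unitfE ?pnatr_eq0 // mulrC.
Qed.

(** * The outer measure given by the largest 2^-K *)

Section APriori.
Variables (R : realType) (n : nat) (U : machine).

(** 0 is adjoined since the supremum of the empty set is [-oo], and [A] may contain no rational
    point. *)
Definition apriori (A : set 'rV[R]_n) : \bar R :=
  ereal_sup (0%E |` [set (2 ^- rat_complexity U q)%:E | q in [set q | A (rat_point R q)]]).

Lemma apriori_ge A q : A (rat_point R q) -> ((2 ^- rat_complexity U q)%:E <= apriori A)%E.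
Proof. by move=> Aq; apply: ereal_sup_ubound; right; exists q. Qed.

Lemma apriori_le A (y : \bar R) : (0 <= y)%E ->
  (forall q, A (rat_point R q) -> ((2 ^- rat_complexity U q)%:E <= y)%E) ->
  (apriori A <= y)%E.
Proof. by move=> y0 Ay; apply: ge_ereal_sup => _ [->//|[q /= /Ay Aq <-]]. Qed.

Lemma apriori_ge0 A : (0 <= apriori A)%E.
Proof. by apply: ereal_sup_ubound; left. Qed.

Lemma apriori0 : apriori set0 = 0%E.
Proof. by apply/eqP; rewrite eq_le apriori_ge0 andbT; apply: apriori_le. Qed.

Lemma le_apriori : {homo apriori : A B / A `<=` B >-> (A <= B)%E}.
Proof.
by move=> A B AB; apply: apriori_le => [|q /AB]; [exact: apriori_ge0|exact: apriori_ge].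
Qed.

(** A point of the union lies in some member, and that single term of the series is large enough. *)
Lemma apriori_sigma_subadditive : sigma_subadditive apriori.
Proof.
move=> F; apply: apriori_le => [|q [i _ Fq]].
  by apply: nneseries_ge0 => i _ _; exact: apriori_ge0.
apply: (le_trans (apriori_ge Fq)).
apply: le_trans (nneseries_lim_ge i.+1 _); last by move=> *; exact: apriori_ge0.
rewrite big_nat_recr //= leeDr // sume_ge0 // => *; exact: apriori_ge0.
Qed.

HB.instance Definition _ := isOuterMeasure.Build R 'rV[R]_n apriori
  apriori0 apriori_ge0 le_apriori apriori_sigma_subadditive.

End APriori.

Lemma rat_point_inj (R : realType) n : injective (@rat_point R n).
Proof. by move=> p q /rowP E; apply/rowP => i; have := E i; rewrite !mxE => /fmorph_inj. Qed.

Lemma rat_pointsE (R : realType) n (A : set 'rV[rat]_n) q :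
  @rat_points R n A (rat_point R q) <-> A q.
Proof. by split=> [[p Ap /rat_point_inj <-]|Aq]; [|exists q]. Qed.

Lemma finite_short_strings k : finite_set [set p : seq bool | (size p <= k)%N].
Proof.
pose s := flatten [seq [seq val t | t <- enum {: i.-tuple bool}] | i <- iota 0 k.+1].
apply: (@sub_finite_set _ _ [set` s]) => [p /= pk|].
  change (p \in s); apply/flatten_mapP; exists (size p); first by rewrite mem_iota.
  by apply/mapP; exists (in_tuple p); rewrite ?mem_enum.
exact: finite_seq.
Qed.

Lemma inverse_power_ge0 o : 0 <= inverse_power o.
Proof. by case: o => [a|] //=; rewrite invr_ge0 exprn_ge0. Qed.

Lemma ler_exp2V (R : realFieldType) a b : (2 ^- a <= 2 ^- b :> R) = (b <= a)%N.
Proof. by rewrite lef_pV2 ?posrE ?exprn_gt0 // ler_eXn2l // ltr1n. Qed.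

Section APrioriOptimal.
Variables (R : realType) (n : nat) (U : machine) (hU : universal_prefix_machine U).

Let program (q : 'rV[rat]_n) : seq bool := 
  s2val (cid2 (complexityP hU (vec_code q)).1).

Let programP q : computes U (program q) (vec_code q).
Proof. exact: s2valP (cid2 (complexityP hU (vec_code q)).1). Qed.

Let size_program q : size (program q) = rat_complexity U q.
Proof. exact: s2valP' (cid2 (complexityP hU (vec_code q)).1). Qed.

Let program_inj : injective program.
Proof.
move=> p q E; apply: (@vec_code_inj n); apply: (computes_inj (programP p)).
by rewrite E; exact: programP.
Qed.

Let rat_complexity_le p q : computes U p (vec_code q) ->
  (@rat_complexity U n q <= size p)%N.
Proof. exact: (complexityP hU (vec_code q)).2. Qed.

Lemma finite_low_complexity k :
  finite_set [set q : 'rV[rat]_n | (rat_complexity U q <= k)%N].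
Proof.
apply: (@sub_finite_set _ _ (program @^-1` [set p | (size p <= k)%N])).
  by move=> q /=; rewrite size_program.
by apply: finite_preimage (finite_short_strings k) => p q _ _; exact: program_inj.
Qed.

Lemma strongly_finite_apriori :
  strongly_finite (@apriori R n U : {outer_measure set 'rV[R]_n -> \bar R}).
Proof.
split.
  apply/eqP; rewrite eq_le apriori_ge0 andbT; apply: apriori_le => // q [].
  by exists q.
apply: le_lt_trans (ltry 1); apply: ge_ereal_sup => _ [A [finA _] <-].
rewrite fsbig_finite //=; set s := fset_set A.
apply: (@le_trans _ _ (\sum_(q <- s) (2 ^- rat_complexity U q)%:E)%E).
  apply: lee_sum => q _; apply: apriori_le => [|p /rat_point_inj -> //].
  by rewrite lee_fin invr_ge0 exprn_ge0.
rewrite sumEFin lee_fin.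
under eq_bigr do rewrite -size_program.
rewrite -(big_map program xpredT (fun p => 2 ^- size p)); apply: kraft.
  by rewrite map_inj_uniq ?fset_uniq //; exact: program_inj.
move=> _ _ /mapP[p _ ->] /mapP[q _ ->]; apply: hU.1.
  by exists (vec_code p); exact: programP.
by exists (vec_code q); exact: programP.
Qed.

Let nu_hat_le (A : {fset 'rV[rat]_n}) t :
  ((ratr (nu_hat U A t))%:E <= apriori U (@rat_points R n [set` A]))%E.
Proof.
have [/(_ _ _)H _] := shortestP U [seq vec_code q | q <- A] t.
rewrite /nu_hat; case E: shortest => [a|]; last by rewrite rmorph0 apriori_ge0.
have [j [p [_ [u [v [_ ov /mapP[q qA vq]]]] ->]]] := H a E.
apply: le_trans (apriori_ge U _ (q := q)); last exact/rat_pointsE.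
rewrite fmorphV rmorphXn rmorph_nat lee_fin ler_exp2V; apply: rat_complexity_le.
by rewrite -vq; apply/outcomeP; exists u.
Qed.

Lemma lower_semicomputable_apriori :
  lower_semicomputable (@apriori R n U : {outer_measure set 'rV[R]_n -> \bar R}).
Proof.
split=> [e e0|].
  have [k ke] : exists k, 2 ^- k < e.
    have [k _ ke] := near_infty_natSinv_expn_lt (PosNum e0).
    by exists k; have := ke k (leqnn k); rewrite /= div1r.
  (* Finitely many points have complexity at most k, and outside them the supremum is at most
     2^-k. *)
  exists (fset_set [set q : 'rV[rat]_n | (rat_complexity U q <= k)%N]).
  apply: le_lt_trans (_ : (2 ^- k)%:E < _)%E; last by rewrite lte_fin.
  apply: apriori_le => [|q Hq]; first by rewrite lee_fin invr_ge0 exprn_ge0.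
  rewrite lee_fin ler_exp2V ltnW // ltnNge; apply/negP => qk; apply: Hq.
  apply/rat_pointsE; rewrite /= in_fset_set ?inE //; exact: finite_low_complexity.
exists (@nu_hat U n); split=> [|A t|A s t st|A].
- exact: computable_nu_hat.
- exact: inverse_power_ge0.
- split; last exact: nu_hat_le.
  rewrite /nu_hat; case E: shortest => [a|]; last exact: inverse_power_ge0.
  have [/(_ _ E)[j [p [js lj ->]]] _] := shortestP U [seq vec_code q | q <- A] s.
  have [_ /(_ j p (leq_trans js st) lj)[b -> bp]] := shortestP U [seq vec_code q | q <- A] t.
  by rewrite /= ler_exp2V.
(* The approximation is eventually constant: from the stage where a shortest program of a simplest
   point of [A] has been run. *)
suff [t0 Ht0] : exists t0, forall t, (t0 <= t)%N ->
    ((ratr (nu_hat U A t))%:E = apriori U (@rat_points R n [set` A]))%E.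
  by apply: cvg_near_cst; exists t0 => // t /= tt0; exact: Ht0.
have [A0|[q0 q0A]] : (forall q, q \notin A) \/ exists q, q \in A.
  have [->|[q qA]] := fset_0Vmem A; [by left => q; rewrite inE|by right; exists q].
  exists 0%N => t _; apply/eqP; rewrite eq_le nu_hat_le /=; apply: apriori_le => [|q].
    by rewrite lee_fin ler0q inverse_power_ge0.
  by move=> /rat_pointsE /=; rewrite (negbTE (A0 q)).
have [k0] : exists k, `[< exists2 q, q \in A & rat_complexity U q = k >].
  by exists (rat_complexity U q0); apply/asboolP; exists q0.
move=> Hk; have [k /asboolP[q qA qk] kmin] := ex_minnP (ex_intro
  (fun k => `[< exists2 q, q \in A & rat_complexity U q = k >]) k0 Hk).
have [u ou] := (outcomeP U _ _).1 (programP q).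
exists (enc (A := seq bool * nat) (program q, u)).+1 => t tt0.
apply/eqP; rewrite eq_le nu_hat_le /=; apply: apriori_le => [|q' /rat_pointsE /= q'A].
  by rewrite lee_fin ler0q inverse_power_ge0.
have lj : listed U [seq vec_code q | q <- A] (enc (A := seq bool * nat) (program q, u)) (program q).
  by exists u, (vec_code q); split=> //; [exact: (encK (A := seq bool * nat))|exact: map_f].
rewrite /nu_hat; have [_ /(_ _ _ tt0 lj)[a -> ap]] := shortestP U [seq vec_code q | q <- A] t.
rewrite /= fmorphV rmorphXn rmorph_nat lee_fin ler_exp2V (leq_trans ap) //.
by rewrite size_program qk kmin //; apply/asboolP; exists q'.
Qed.

End APrioriOptimal.

(** * Cubes of large measure contain simple points *)

Section Cubes.
Variables (R : realType) (n : nat).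
Implicit Types (y : 'rV[R]_n) (m : 'rV[int]_n) (q : 'rV[rat]_n).

Lemma dyadic_cubeP r m y : dyadic_cube r m y <->
  forall i, (m 0 i)%:~R <= 2 ^+ r * y 0 i < (m 0 i)%:~R + 1.
Proof.
have r0 : (2 : R) ^+ r != 0 by rewrite expf_neq0 // pnatr_eq0.
split=> [[x Hx <-] i|Hy]; first by rewrite mxE mulrA divff // mul1r.
by exists (2 ^+ r *: y) => [i /=|]; rewrite ?mxE // scalerA mulVf // scale1r.
Qed.

Lemma scaled_floor_bounds r (a : rat) :
  (scaled_floor r (numq a, denq a))%:~R <= 2 ^+ r * ratr a :> R /\
  2 ^+ r * ratr a < (scaled_floor r (numq a, denq a))%:~R + 1 :> R.
Proof.
rewrite scaled_floorE ?denq_gt0 //=; set N := (Posz (2 ^ r) * numq a); set d := denq a.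
have d0 : (0 < d)%R by exact: denq_gt0.
have d0' : (0 : R) < d%:~R by rewrite ltr0z.
have -> : 2 ^+ r * ratr a = N%:~R / d%:~R :> R.
  by rewrite /N intrM mulrA -[in RHS]pmulrn natrX.
rewrite ler_pdivlMr // ltr_pdivrMr // (_ : _ + 1 = (divz N d + 1)%:~R) ?intrD //.
rewrite -intrD -!intrM ler_int ltr_int.
rewrite {3}(divz_eq N d) [X in _ < X]mulrDl mul1r {2}(divz_eq N d).
by rewrite lerDl modz_ge0 ?gt_eqF // ltrD2l ltz_pmod.
Qed.

Lemma cube_keyP r m q : dyadic_cube r m (rat_point R q) <->
  cube_key r (raw q) = [seq m 0 i | i <- enum 'I_n].
Proof.
rewrite /cube_key -map_comp; split=> [/dyadic_cubeP Hq|/eq_in_map Hq].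
  apply: eq_map => i /=; have := Hq i; rewrite mxE => /andP[m1 m2].
  have [f1 f2] := scaled_floor_bounds r (q 0 i).
  apply/eqP; rewrite eq_le -!ltzD1 -!(ltr_int R) !intrD.
  by rewrite (le_lt_trans f1 m2) (le_lt_trans m1 f2).
apply/dyadic_cubeP => i; rewrite mxE -(Hq i (mem_enum _ _)) /=.
by have [-> ->] := scaled_floor_bounds r (q 0 i).
Qed.

End Cubes.

(** * Counting the cubes of large measure *)

Section Enumeration.
Variables (R : realType) (n : nat).
Variables (mu : {outer_measure set 'rV[R]_n -> \bar R}).
Variables (muhat : {fset 'rV[rat]_n} -> nat -> rat) (M : machine).
Hypothesis HM : forall (s : seq 'rV[rat]_n) (t : nat),
  computes M (list_code s ++ nat_code t) (rat_code (muhat [fset q in s]%fset t)).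
Hypothesis muhat_le : forall A t, ((ratr (muhat A t))%:E <= mu (@rat_points R n [set` A]))%E.

Lemma outer_measure_seq (s : seq 'rV[rat]_n) :
  (mu (@rat_points R n [set` s]) <= \sum_(q <- s) mu [set rat_point R q])%E.
Proof.
elim: s => [|q s IH].
  by rewrite big_nil (_ : rat_points _ = set0) ?outer_measure0 // set_nil /rat_points image_set0.
rewrite big_cons; apply: le_trans (leeD (lexx _) IH).
apply: le_trans (outer_measureU2 _ _ _); apply: le_outer_measure.
move=> _ [p + <-]; rewrite /= inE => /predU1P[->|ps]; [by left|right].
by exists p.
Qed.

Lemma pow2_lt_ratr (a : rat) k : (0 < numq a)%R ->
  (2 ^- k < ratr a :> R) = (`|denq a| < `|numq a| * 2 ^ k)%N.
Proof.
move=> a0.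
rewrite [ratr a]/(_ / _) -[X in _ = X]ltz_nat PoszM !gez0_abs ?ltW ?denq_gt0 //.
rewrite ltr_pdivlMr ?ltr0z ?denq_gt0 // mulrC ltr_pdivrMr ?exprn_gt0 //.
by rewrite -[2 ^+ k]natrX [(_ ^ k)%:R]pmulrn -intrM ltr_int.
Qed.

Lemma correct_guessP r k g : correct_guess M n r k g ->
  exists s : seq 'rV[rat]_n, [/\ s <> [::], g.1.1 = map (@raw n) s,
    forall q, q \in s -> cube_key r (raw q) = cube_key r (head [::] g.1.1) &
    ((2 ^- k)%:E < mu (@rat_points R n [set` s]))%E].
Proof.
case: g => [[A t] [u [a d]]]; rewrite /correct_guess; cbn [fst snd].
move=> /and5P[A0 /allP Av /allP Ak /eqP oA /andP[a0 ad]].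
have [s As] : exists s : seq 'rV[rat]_n, A = map (@raw n) s.
  elim: (A) Av => [|v l IH] lv; first by exists [::].
  have [q ->] := valid_rawP n v (lv v (mem_head _ _)).
  have [w wl|s ->] := IH; first by apply: lv; rewrite inE wl orbT.
  by exists (q :: s).
exists s; split=> //.
- by move=> s0; rewrite As s0 in A0.
- by move=> q qs; apply/eqP/Ak; rewrite As map_f.
apply: lt_le_trans (le_trans (muhat_le [fset q in s]%fset t) _); last first.
  apply: le_outer_measure => _ [q + <-]; rewrite /= inE => qs; by exists q.
have := HM s t; rewrite list_codeE -As => HA.
(* [M] is deterministic, so the guessed output is the true value of [muhat], a lower bound of
   [mu]. *)
have /(computes_inj HA) : computes M (raw_list_code A ++ nat_code t) (int_code a ++ int_code d).
  by apply/outcomeP; exists u.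
rewrite /rat_code -[int_code (denq _)]cats0 -[int_code d]cats0.
move=> /int_code_cat[aE /int_code_cat[dE _]].
by rewrite lte_fin pow2_lt_ratr aE ?dE.
Qed.

(** [B] collects the points of the guesses that introduced a representative. New cubes bring new
    points, so each guess adds at least 2^-k to the sum over singletons. *)
Lemma cube_reps_inv r k N : exists B : seq 'rV[rat]_n,
  [/\ uniq B,
      forall q, q \in B -> cube_key r (raw q) \in map (cube_key r) (cube_reps M n r k N),
      forall v, v \in cube_reps M n r k N -> exists q : 'rV[rat]_n, v = raw q &
      ((2 ^- k *+ size (cube_reps M n r k N))%:E <= \sum_(q <- B) mu [set rat_point R q])%E].
Proof.
elim: N => [|N [B [uB BL Lraw leB]]]; first by exists [::]; rewrite big_nil.
rewrite cube_repsS; case: ifP => [/andP[cg nc]|_]; last by rewrite cats0; exists B.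
have [s [s0 sE sk lts]] := correct_guessP cg.
set v := head [::] _ in nc sk *.
have vE : exists q : 'rV[rat]_n, v = raw q.
  by rewrite /v sE; case: (s) s0 => // q l _; exists q.
exists (undup s ++ B); split.
- rewrite cat_uniq undup_uniq uB andbT; apply/hasPn => q /BL /mapP[w wL qw].
  rewrite mem_undup; apply/negP => /sk; rewrite qw => wv.
  by have /allP/(_ w wL) := nc; rewrite wv eqxx.
- move=> q; rewrite mem_cat mem_undup map_cat mem_cat => /orP[/sk ->|/BL -> //].
  by rewrite inE eqxx orbT.
- by move=> w; rewrite mem_cat inE => /orP[/Lraw//|/eqP ->].
rewrite size_cat addn1 mulrS EFinD big_cat /= leeD //.
apply: le_trans (ltW lts) _; apply: le_trans (outer_measure_seq _).
by apply: le_outer_measure => _ [q /= qs <-]; exists q => //=; rewrite mem_undup.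
Qed.

End Enumeration.

(** * Short descriptions of points in cubes of large measure *)

Section Coding.
Variables (R : realType) (n : nat) (U : machine) (hU : universal_prefix_machine U).
Variables (mu : {outer_measure set 'rV[R]_n -> \bar R}).
Hypotheses (fmu : strongly_finite mu) (lmu : lower_semicomputable mu).

Lemma sum_singletons_le (B : seq 'rV[rat]_n) : uniq B ->
  (\sum_(q <- B) mu [set rat_point R q] <=
   \esum_(q in [set: 'rV[rat]_n]) mu [set rat_point R q])%E.
Proof.
move=> uB; apply: esum_ge; exists [set` B]; first by split=> //; exact: finite_seq.
by rewrite fsbig_seq.
Qed.

Lemma esum_singletons_bound : exists c : nat,
  (\esum_(q in [set: 'rV[rat]_n]) mu [set rat_point R q] <= (2 ^+ c)%:E)%E.
Proof.
have [_] := fmu; case E: (esum _ _) => [x| |] // _; last by exists 0%N; rewrite leNye.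
exists (Num.bound `|x|); rewrite lee_fin; apply: le_trans (ler_norm _) _.
apply: le_trans (ltW (archi_boundP (normr_ge0 _))) _.
by rewrite -natrX ler_nat; apply: leq_trans (ltnW (ltn_expl _ (ltnSn 1))) _.
Qed.

Lemma outer_measure_finite : exists c : nat, forall A, (mu A <= (2 ^+ c)%:E)%E.
Proof.
have [c Hc] := esum_singletons_bound; have [/(_ 1 ltr01)[F HF] _] := lmu.
(* A finite set carries all but measure 1, and 2^c + 1 is at most 2^(c+1). *)
exists c.+1 => A; apply: le_trans (le_outer_measureIC mu (@rat_points R n [set` F]) A) _.
rewrite exprS mulr_natl mulr2n EFinD leeD //.
  apply: le_trans (le_outer_measure mu _ _ (@subIsetr _ _ _)) _.
  apply: le_trans (outer_measure_seq mu F) _.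
  exact: le_trans (sum_singletons_le (fset_uniq F)) Hc.
apply: le_trans (le_outer_measure mu _ _ (@subIsetr _ _ _)) _.
by apply: le_trans (ltW HF) _; rewrite lee_fin exprn_ege1 // ler1n.
Qed.

Lemma finite_subset_measure (E : set 'rV[R]_n) (b : R) : (b%:E < mu E)%E ->
  exists2 A : {fset 'rV[rat]_n}, (b%:E < mu (@rat_points R n [set` A]))%E &
    forall q, q \in A -> E (rat_point R q).
Proof.
move=> bE; have [c /(_ E) Ec] := outer_measure_finite.
have Efin : mu E \is a fin_num.
  by rewrite ge0_fin_numE ?outer_measure_ge0 // (le_lt_trans Ec) // ltry.
(* This gap is the measure that may be discarded outside a finite set. *)
have e0 : 0 < fine (mu E) - b by rewrite subr_gt0 -lte_fin fineK.
have [/(_ _ e0)[F HF] _] := lmu.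
exists [fset q in F | `[< E (rat_point R q) >]]%fset; last first.
  by move=> q; rewrite !inE => /andP[_ /asboolP].
have : (mu E <= mu (@rat_points R n [set` [fset q in F | `[< E (rat_point R q) >]]%fset]) +
    mu (~` @rat_points R n [set` F]))%E.
  apply: le_trans (le_outer_measureIC mu (@rat_points R n [set` F]) E) _.
  apply: leeD; apply: le_outer_measure; last exact: subIsetr.
  move=> y [Ey [q qF qy]]; exists q => //; rewrite /= !inE; apply/andP; split=> //.
  by apply/asboolP; rewrite qy.
set a := mu _ => le_E; rewrite ltNge; apply/negP => ab.
suff : (mu E < mu E)%E by rewrite ltxx.
apply: le_lt_trans le_E _; apply: le_lt_trans (leeD ab (lexx _)) _.
rewrite -[X in (_ < X)%E](fineK Efin) -[fine (mu E)](subrKC b) EFinD.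
by rewrite lteD2lE.
Qed.

Theorem complexity_cube : exists C : nat, forall r m k,
  ((2 ^- k)%:E < mu (dyadic_cube r m))%E ->
  exists2 q : 'rV[rat]_n, dyadic_cube r m (rat_point R q) &
    (rat_complexity U q <= size (nat_code r) + size (nat_code k) + k + C)%N.
Proof.
have [_ [muhat [[M HM] _ muhat_mon muhat_cvg]]] := lmu.
have muhat_le A t : ((ratr (muhat A t))%:E <= mu (@rat_points R n [set` A]))%E.
  by have [] := muhat_mon A t t (leqnn t).
have [c Hc] := esum_singletons_bound.
have [M' pM' HM'] := cube_machine M n c.
have [c' Hc'] := hU.2 M' pM'.
(* 2^c bounds the sum over singletons, so at most 2^(k+c) cubes are listed; [c'] is the cost of
   passing to [U]. *)
exists (c + c')%N => r m k ltk.
have size_reps N : (size (cube_reps M n r k N) <= 2 ^ (k + c))%N.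
  have [B [uB _ _ leB]] := cube_reps_inv HM muhat_le r k N.
  have := le_trans leB (le_trans (sum_singletons_le uB) Hc).
  rewrite lee_fin -[X in X <= _]mulr_natr ler_pdivrMl ?exprn_gt0 // -exprD -natrX ler_nat.
  by [].
have [A ltA AE] := finite_subset_measure ltk.
have [t ltt] : exists t, 2 ^- k < ratr (muhat A t) :> R.
  apply/not_existsP => Hle; move: ltA; rewrite ltNge => /negP; apply.
  apply: (cvge_le _ (muhat_cvg A)); apply: nearW => t /=.
  by rewrite lee_fin leNgt; apply/negP; exact: Hle.
have /outcomeP[u ou] : computes M (list_code A ++ nat_code t) (rat_code (muhat A t)).
  have := HM A t; rewrite (_ : [fset q in _]%fset = A) //.
  by apply/fsetP => q; rewrite !inE.
pose a := muhat A t.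
have a0 : 0 < numq a.
  by rewrite numq_gt0 -(ltr0q R); apply: lt_trans ltt; rewrite invr_gt0 exprn_gt0.
pose g : guess := ((map (@raw n) A, t), (u, (numq a, denq a))).
have [q0 [l A_cons]] : exists q0 l, A = q0 :: l :> seq _.
  case E : (A : seq _) => [|q0 l]; last by exists q0, l.
  move: ltA; rewrite ltNge (_ : rat_points _ = set0) ?outer_measure0 ?lee_fin.
    by rewrite invr_ge0 exprn_ge0.
  by apply/seteqP; split=> // y [q qA _]; have : q \in (A : seq _) := qA; rewrite E.
have A0 : map (@raw n) A != [::] by rewrite A_cons.
have keyE q : q \in A -> cube_key r (raw q) = [seq m 0 i | i <- enum 'I_n].
  by move=> /AE /cube_keyP.
have headE : cube_key r (head [::] (map (@raw n) A)) = [seq m 0 i | i <- enum 'I_n].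
  by rewrite A_cons; apply: keyE; rewrite -[_ \in _]/(q0 \in (A : seq _)) A_cons mem_head.
have cg : correct_guess M n r k g.
  rewrite /correct_guess; cbn [fst snd]; apply/and5P; split=> //.
  - by apply/allP => _ /mapP[q _ ->]; apply/valid_rawP; exists q.
  - by apply/allP => _ /mapP[q qA ->]; rewrite headE keyE.
  - by rewrite -list_codeE ou.
  by rewrite a0 -(pow2_lt_ratr R).
(* At the turn of the guess [g] its cube is either appended or already listed; in the latter case
   the representative comes from another guess. *)
have [N [v vN vk]] : exists N, exists2 v, v \in cube_reps M n r k N &
    cube_key r v = [seq m 0 i | i <- enum 'I_n].
  exists (enc (A := guess) g).+1; rewrite cube_repsS (encK (A := guess)) cg [_.1.1]/=.
  case: ifP => [_|].
    by exists (head [::] (map (@raw n) A)) => //; rewrite mem_cat inE eqxx orbT.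
  move=> /allPn[w wL /negPn/eqP wk]; exists w; first by rewrite cats0.
  by rewrite wk headE.
have [B [_ _ /(_ v vN)[q vq] _]] := cube_reps_inv HM muhat_le r k N.
exists q; first by apply/cube_keyP; rewrite -vq.
have [p pv szp] := HM' r k _ v vN (size_reps _).
have [p' p'v szp'] := Hc' _ _ pv.
apply: leq_trans ((complexityP hU _).2 p' _) (leq_trans szp' _).
  by rewrite vec_codeE -vq.
by rewrite szp; lia.
Qed.

End Coding.

(** * Comparing lower and upper growth rates *)

Section Limits.
Variable R : realType.
Implicit Types (u v : (\bar R)^nat) (a b : nat -> R).

Lemma limn_esup_lt u (y : \bar R) : (limn_esup u < y)%E ->
  \forall r \near \oo, (u r < y)%E.
Proof.
move=> /ereal_inf_lt[_ [V oV <-] Vy]; apply: filterS oV => r Vr.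
by apply: le_lt_trans Vy; apply: ereal_sup_ubound; exists r.
Qed.

Lemma limn_esup_le u (y : \bar R) : (\forall r \near \oo, (u r <= y)%E) ->
  (limn_esup u <= y)%E.
Proof.
move=> uy; apply: (@le_trans _ _ (ereal_sup (u @` [set r | (u r <= y)%E]))).
  by apply: ereal_inf_lbound; exists [set r | (u r <= y)%E].
by apply: ge_ereal_sup => _ [r ry <-].
Qed.

Lemma limn_einf_gt u (y : \bar R) : (y < limn_einf u)%E ->
  \forall r \near \oo, (y < u r)%E.
Proof.
rewrite /limn_einf lteNr => /limn_esup_lt; apply: filterS => r.
by rewrite lteN2.
Qed.

Lemma limn_einf_ge u (y : \bar R) : (\forall r \near \oo, (y <= u r)%E) ->
  (y <= limn_einf u)%E.
Proof.
move=> uy; rewrite /limn_einf leeNr; apply: limn_esup_le.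
by apply: filterS uy => r; rewrite leeN2.
Qed.

Lemma near_addn (P : nat -> Prop) c :
  (\forall r \near \oo, P r) <-> (\forall r \near \oo, P (r + c)%N).
Proof.
split=> -[N _ HN]; first by exists N => // r /= Nr; apply: HN; rewrite /= (leq_trans Nr) ?leq_addr.
exists (N + c)%N => // r /= Nr; rewrite -(subnK (leq_trans (leq_addl N c) Nr)).
by apply: HN; rewrite /= leq_subRL ?(leq_trans (leq_addl N c) Nr) // addnC.
Qed.

Lemma near_linear (d K : R) : 0 < d -> \forall r \near \oo, K <= d * r%:R.
Proof.
move=> d0; exists (Num.bound `|K / d|) => // r /= Kr.
rewrite mulrC -ler_pdivrMr //; apply: le_trans (ler_norm _) _.
apply: le_trans (ltW (archi_boundP (normr_ge0 _))) _.
by rewrite ler_nat.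
Qed.

Lemma ereal_between (x y : \bar R) : (x < y)%E -> exists2 z : R, (x < z%:E)%E & (z%:E < y)%E.
Proof.
case: x => [x| |]; case: y => [y| |] //=.
- rewrite lte_fin => xy; exists ((x + y) / 2); rewrite lte_fin; lra.
- by move=> _; exists (x + 1); rewrite ?ltry // lte_fin ltrDl.
- by move=> _; exists (y - 1); rewrite ?ltNyr // lte_fin; lra.
- by move=> _; exists 0; rewrite ?ltNyr ?ltry.
Qed.

(** The shift [c] pays for passing between balls and cubes, the factor 1 + e for the code of k, and
    the term e * r for the code of r and for the o(r) of domination. *)
Definition asymptotically_le b a : Prop :=
  forall e : R, 0 < e -> exists c : nat,
    \forall r \near \oo, b r <= (1 + e) * a (r + c)%N + e * r%:R.

Lemma slope_slack (y y' : R) : y < y' -> exists2 e, 0 < e &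
  forall c : nat, \forall r \near \oo, (1 + e) * (y * (r + c)%:R) + e * r%:R <= y' * r%:R.
Proof.
(* With this e, the slope y + e y + e stays below the midpoint of y and y'; the other half of the
   gap absorbs the constant due to the shift. *)
move=> yy'; pose e := (y' - y) / (4 * (`|y| + 1)).
have y0 : 0 < `|y| + 1 by rewrite ltr_wpDl.
have e0 : 0 < e by rewrite divr_gt0 ?subr_gt0 // mulr_gt0.
have ey : e * (`|y| + 1) = (y' - y) / 4 by rewrite /e; field; rewrite gt_eqF.
exists e => // c.
have d0 : 0 < (y' - y) / 2 by rewrite divr_gt0 ?subr_gt0.
near=> r.
have : (1 + e) * y * c%:R <= (y' - y) / 2 * r%:R by near: r; exact: near_linear.
have : e * y <= e * `|y| by rewrite ler_pM2l // ler_norm.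
have r0 : 0 <= r%:R :> R by [].
rewrite natrD => h1 h2.
have h3 : (y + e * y + e) * r%:R <= (y' - (y' - y) / 2) * r%:R.
  by apply: ler_wpM2r => //; lra.
by nra.
Unshelve. all: by end_near. Qed.

Variables (a b : nat -> R) (u v : (\bar R)^nat).
Hypothesis ba : asymptotically_le b a.
Hypothesis ua : \forall r \near \oo, u r = (a r / r%:R)%:E.
Hypothesis vb : \forall r \near \oo, v r = (b r / r%:R)%:E.

Lemma le_limn_esup : (limn_esup v <= limn_esup u)%E.
Proof.
rewrite leNgt; apply/negP => /ereal_between[y uy /ereal_between[y' yy' y'v]].
rewrite lte_fin in yy'; have [e e0 slack] := slope_slack yy'.
have [c bac] := ba e0.
suff : (limn_esup v <= y'%:E)%E by rewrite leNgt y'v.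
apply: limn_esup_le; near=> r.
have r0 : 0 < r%:R :> R by rewrite ltr0n; near: r; exists 1%N.
have -> : v r = (b r / r%:R)%:E by near: r.
rewrite lee_fin ler_pdivrMr //.
have h1 : b r <= (1 + e) * a (r + c)%N + e * r%:R by near: r.
have h2 : (1 + e) * (y * (r + c)%:R) + e * r%:R <= y' * r%:R by near: r; exact: slack.
have : a (r + c)%N <= y * (r + c)%:R.
  have rc0 : 0 < (r + c)%:R :> R by rewrite natrD ltr_wpDr.
  rewrite -ler_pdivrMr // -lee_fin ltW //.
  have <- : u (r + c)%N = (a (r + c)%N / (r + c)%:R)%:E.
    by near: r; by have /(near_addn _ c) := ua.
  by near: r; by have /(near_addn _ c) := limn_esup_lt uy.
by nra.
Unshelve. all: by end_near. Qed.

Lemma le_limn_einf : (limn_einf v <= limn_einf u)%E.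
Proof.
rewrite leNgt; apply/negP => /ereal_between[y uy /ereal_between[y' yy' y'v]].
rewrite lte_fin in yy'; have [e e0 slack] := slope_slack yy'.
have [c bac] := ba e0.
suff : (y%:E <= limn_einf u)%E by rewrite leNgt uy.
(* Here the inequality is read backwards: b r is at least y' r, which forces a (r + c) to be at
   least y (r + c). *)
apply: limn_einf_ge; apply/(near_addn _ c); near=> r.
have r0 : 0 < r%:R :> R by rewrite ltr0n; near: r; exists 1%N.
have rc0 : 0 < (r + c)%:R :> R by rewrite natrD ltr_wpDr.
have -> : u (r + c)%N = (a (r + c)%N / (r + c)%:R)%:E.
  by near: r; by have /(near_addn _ c) := ua.
rewrite lee_fin ler_pdivlMr //.
have h1 : b r <= (1 + e) * a (r + c)%N + e * r%:R by near: r.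
have h2 : (1 + e) * (y * (r + c)%:R) + e * r%:R <= y' * r%:R by near: r; exact: slack.
have h3 : y' * r%:R <= b r.
  rewrite -ler_pdivlMr // -lee_fin ltW //.
  have <- : v r = (b r / r%:R)%:E by near: r.
  by near: r; exact: limn_einf_gt.
rewrite -(ler_pM2l (_ : 0 < 1 + e)); first by lra.
by rewrite addr_gt0.
Unshelve. all: by end_near. Qed.

End Limits.

(** * Balls and dyadic cubes *)

Section Geometry.
Variables (R : realType) (n : nat).
Implicit Types (x y v : 'rV[R]_n) (q : 'rV[rat]_n).

Lemma coord_le_norm v i : `|v 0 i| <= euclidean_norm v.
Proof.
rewrite -sqrtr_sqr ler_wsqrtr // (bigD1 i) //= lerDl sumr_ge0 // => j _.
exact: sqr_ge0.
Qed.

Lemma norm_le_coord v (b : R) : 0 <= b -> (forall i, `|v 0 i| <= b) ->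
  euclidean_norm v <= n%:R * b.
Proof.
move=> b0 vb; have nb0 : 0 <= n%:R * b by rewrite mulr_ge0.
rewrite -(ger0_norm nb0) -sqrtr_sqr ler_wsqrtr //.
apply: (@le_trans _ _ (n%:R * b ^+ 2)).
  rewrite -[n in n%:R]card_ord -sum1_card natr_sum mulr_suml; apply: ler_sum => i _.
  by rewrite mul1r -real_normK ?num_real // ler_sqr ?nnegrE.
rewrite exprMn ler_wpM2r ?sqr_ge0 // -natrX ler_nat.
by case: (n) => // k; rewrite leq_pmulr.
Qed.

Variable x : 'rV[R]_n.
Definition cube_of r y : 'rV[int]_n := \row_i Num.floor (2 ^+ r * y 0 i).

Lemma cube_ofP r y : dyadic_cube r (cube_of r y) y.
Proof.
apply/dyadic_cubeP => i; rewrite mxE ge_floor.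
by have := lt_succ_floor (2 ^+ r * y 0 i); rewrite intrD.
Qed.

Lemma scaled_dist r (a b d : R) : `|2 ^+ r * a - 2 ^+ r * b| <= d ->
  `|a - b| <= d * 2 ^- r.
Proof.
by rewrite -mulrBr normrM ger0_norm ?exprn_ge0 // mulrC ler_pdivlMr ?exprn_gt0.
Qed.

Definition neighbour r (d : {ffun 'I_n -> 'I_3}) : 'rV[int]_n :=
  \row_i (cube_of r x 0 i + Posz (d i) - 1).

(** Coordinates scaled by 2^r differ by less than 1, so their floors differ by at most 1;
    [neighbour] stores that difference plus 1 in ['I_3]. *)
Lemma ball_cover r : euclidean_ball x (2 ^- r) `<=`
  [set y | exists2 d, d \in enum {ffun 'I_n -> 'I_3} & dyadic_cube r (neighbour r d) y].
Proof.
move=> y yx; pose z i : int := cube_of r y 0 i - cube_of r x 0 i + 1.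
have z03 i : (0 <= z i < 3)%R.
  have /dyadic_cubeP/(_ i)/andP[x1 x2] := cube_ofP r x.
  have /dyadic_cubeP/(_ i)/andP[y1 y2] := cube_ofP r y.
  have : `|y 0 i - x 0 i| < 2 ^- r.
    by apply: le_lt_trans yx; have := coord_le_norm (y - x) i; rewrite !mxE.
  rewrite -(ltr_pM2l (_ : 0 < 2 ^+ r)) ?exprn_gt0 // divff ?expf_neq0 ?pnatr_eq0 //.
  rewrite -[X in X * `|_|](ger0_norm (_ : 0 <= 2 ^+ r)) ?exprn_ge0 // -normrM mulrBr.
  rewrite ltr_norml => /andP[h1 h2].
  have l1 : ((cube_of r x 0 i)%:~R : R) < (cube_of r y 0 i + 2)%:~R by rewrite intrD; lra.
  have l2 : ((cube_of r y 0 i)%:~R : R) < (cube_of r x 0 i + 2)%:~R by rewrite intrD; lra.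
  by move: l1 l2; rewrite !ltr_int /z; lia.
exists [ffun i => inord `|z i|%N]; first by rewrite mem_enum.
apply/dyadic_cubeP => i; rewrite mxE ffunE.
have /andP[z0 z3] := z03 i.
have -> : cube_of r x 0 i + Posz (inord `|z i|%N : 'I_3) - 1 = cube_of r y 0 i.
  by rewrite inordK; [rewrite gez0_abs // /z; ring | lia].
by have /dyadic_cubeP/(_ i) := cube_ofP r y.
Qed.

Variable c : nat.
Hypothesis nc : (2 * n < 2 ^ c)%N.

(** Origin of the bound on [c]: in both uses a coordinate is off by at most two sides of a cube, and
    the Euclidean norm costs at most another factor n. *)
Lemma norm_lt_scaled r v : (forall i, `|v 0 i| <= 2 * 2 ^- (r + c)) ->
  euclidean_norm v < 2 ^- r.
Proof.
move=> vb; apply: le_lt_trans (norm_le_coord _ vb) _.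
  by rewrite mulr_ge0 // invr_ge0 exprn_ge0.
rewrite mulrA exprD invfM mulrCA -[X in _ < X]mulr1 ltr_pM2l ?invr_gt0 ?exprn_gt0 //.
by rewrite ltr_pdivrMr ?exprn_gt0 // mul1r -natrM -natrX ltr_nat mulnC.
Qed.

Lemma cube_sub_ball r y z :
  euclidean_norm (z - x) < 2 ^- (r + c) ->
  dyadic_cube (r + c) (cube_of (r + c) z) y -> euclidean_ball x (2 ^- r) y.
Proof.
move=> zx /dyadic_cubeP Hy; apply: norm_lt_scaled => i; rewrite !mxE.
have /dyadic_cubeP/(_ i) := cube_ofP (r + c) z; have := Hy i.
set m := _%:~R => /andP[y1 y2] /andP[z1 z2].
have h1 : `|y 0 i - z 0 i| <= 1 * 2 ^- (r + c).
  by apply: scaled_dist; rewrite ler_norml; apply/andP; split; lra.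
have h2 : `|z 0 i - x 0 i| <= 2 ^- (r + c).
  by apply: le_trans (ltW zx); have := coord_le_norm (z - x) i; rewrite !mxE.
have -> : y 0 i - x 0 i = (y 0 i - z 0 i) + (z 0 i - x 0 i) by rewrite addrA subrK.
apply: le_trans (ler_normD _ _) _; lra.
Qed.

Lemma neighbour_dist r d z : dyadic_cube (r + c) (neighbour (r + c) d) z ->
  euclidean_norm (z - x) < 2 ^- r.
Proof.
move=> /dyadic_cubeP Hz; apply: norm_lt_scaled => i; rewrite !mxE.
apply: scaled_dist; have /dyadic_cubeP/(_ i)/andP[x1 x2] := cube_ofP (r + c) x.
have := Hz i; rewrite mxE intrB intrD => /andP[z1 z2].
have d3 : (Posz (d i))%:~R <= 2 :> R by rewrite -pmulrn ler_nat -ltnS.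
have d0 : 0 <= (Posz (d i))%:~R :> R by rewrite ler0z.
by rewrite ler_norml; apply/andP; split; lra.
Qed.

End Geometry.

Lemma outer_measure_cover (R : realType) (T : Type) (I : eqType)
    (mu : {outer_measure set T -> \bar R}) (s : seq I) (F : I -> set T) :
  (mu [set y | exists2 i, i \in s & F i y] <= \sum_(i <- s) mu (F i))%E.
Proof.
elim: s => [|i s IH].
  by rewrite big_nil (_ : [set _ | _] = set0) ?outer_measure0 //; apply/seteqP; split=> // y [].
rewrite big_cons; apply: le_trans (leeD (lexx _) IH).
apply: le_trans (outer_measureU2 _ _ _); apply: le_outer_measure.
by move=> y [j]; rewrite inE => /predU1P[->|js]; [left|right; exists j].
Qed.

(** * Local dimensions *)

Lemma sqr_le_exp2 t : (t ^ 2 <= 2 ^ t + 1)%N.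
Proof.
case: (ltnP t 3) => [|t3]; first by case: t => [|[|[|]]].
rewrite -(subnK t3); elim: (t - 3)%N => // k; set m := (k + 3)%N => IH.
have l : (2 * m + 1 <= 2 ^ m)%N.
  rewrite /m; elim: (k) => // j jH; rewrite addSn expnS; lia.
by rewrite addSn -/m -(addn1 m) sqrnD expnD muln1; lia.
Qed.

(** With t the binary logarithm of k, 2 t is at most e t^2 + 1/e because e (t - 1/e)^2 is
    nonnegative, and t^2 is at most k + 1. *)
Lemma size_nat_code_little (R : realType) (e : R) : 0 < e -> exists C : R, forall k,
  (size (nat_code k))%:R <= e * k%:R + C.
Proof.
move=> e0; exists (e + e^-1 + 4) => k; rewrite size_nat_code natrD natrM.
set t : R := (trunc_log 2 k)%:R.
have tk : t ^+ 2 <= k%:R + 1.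
  rewrite /t -natrX natr1 ler_nat -[k.+1]addn1; case: (posnP k) => [->|k0].
    by rewrite trunc_log0.
  by apply: leq_trans (sqr_le_exp2 _) _; rewrite leq_add2r trunc_logP.
have ee : e * e^-1 = 1 by rewrite divff ?gt_eqF.
have : 2 * t <= e * t ^+ 2 + e^-1.
  rewrite -subr_ge0 (_ : _ - _ = e * (t - e^-1) ^+ 2).
    by rewrite mulr_ge0 ?sqr_ge0 // ltW.
  by field; rewrite gt_eqF.
have : e * t ^+ 2 <= e * (k%:R + 1) by rewrite ler_pM2l.
by lra.
Qed.

Section Main.
Variables (R : realType) (n : nat) (U : machine) (hU : universal_prefix_machine U).
Variables (mu : {outer_measure set 'rV[R]_n -> \bar R}) (hmu : locally_optimal mu).
Variable x : 'rV[R]_n.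

Let c : nat := (2 * n)%N.

Let nc : (2 * n < 2 ^ c)%N. Proof. exact: ltn_expl. Qed.

Lemma complexity_atP r : exists2 q : 'rV[rat]_n,
  euclidean_norm (rat_point R q - x) < 2 ^- r & rat_complexity U q = complexity_at U x r.
Proof.
have [|[q /= qx qE] _] := @min_natP [set rat_complexity U q | q in
    [set q : 'rV[rat]_n | euclidean_norm (rat_point R q - x) < 2 ^- r]]; last by exists q.
(* Truncating the binary expansions of the coordinates shows that rational points occur in the
   ball. *)
pose q : 'rV[rat]_n := \row_i ((Num.floor (2 ^+ (r + c) * x 0 i))%:~R / 2 ^+ (r + c)).
exists (rat_complexity U q), q => //=; apply: (norm_lt_scaled nc) => i.
rewrite !mxE; apply: scaled_dist.
rewrite fmorph_div rmorph_int rmorphXn rmorph_nat mulrCA divff ?expf_neq0 ?pnatr_eq0 // mulr1.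
have := ge_floor (2 ^+ (r + c) * x 0 i); have := lt_succ_floor (2 ^+ (r + c) * x 0 i).
rewrite intrD => h1 h2; rewrite ler_norml; apply/andP; split; lra.
Qed.

Lemma complexity_at_le r q : euclidean_norm (rat_point R q - x) < 2 ^- r ->
  (complexity_at U x r <= rat_complexity U q)%N.
Proof.
move=> qx; have [|_ H] := @min_natP [set rat_complexity U q | q in
    [set q : 'rV[rat]_n | euclidean_norm (rat_point R q - x) < 2 ^- r]].
  by exists (rat_complexity U q), q.
by apply: H; exists q.
Qed.

Let ball r := mu (euclidean_ball x (2 ^- r)).

Lemma ball_lower_bound : exists2 e : nat -> R, e =o_\oo (fun r => r%:R : R) &
  forall r, ((2 `^ (- e (r + c)%N) * 2 ^- complexity_at U x (r + c))%:E <= ball r)%E.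
Proof.
have [_ _ /(_ (@apriori R n U : {outer_measure set 'rV[R]_n -> \bar R})
  (strongly_finite_apriori R n hU) (lower_semicomputable_apriori R n hU))] := hmu.
move=> [beta [beta0 [e eo betaE] dom]]; exists e => // r.
have [q qx <-] := complexity_atP (r + c).
rewrite -betaE EFinM.
apply: (@le_trans _ _ (mu (dyadic_cube (r + c) (cube_of (r + c) (rat_point R q))))); last first.
  by apply: le_outer_measure => y; exact: cube_sub_ball.
apply: le_trans (dom _ _); rewrite lee_pmul2l ?fin_numE // ?lte_fin //.
apply: apriori_ge; exact: cube_ofP.
Qed.

Let mB r : R := fine (ball r).

Lemma ballE r : ball r = (mB r)%:E.
Proof.
have [c' /(_ (euclidean_ball x (2 ^- r)))] := outer_measure_finite (let: And3 a _ _ := hmu in a)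
  (let: And3 _ b _ := hmu in b).
rewrite /mB /ball => le1; rewrite fineK // ge0_fin_numE ?outer_measure_ge0 //.
exact: le_lt_trans le1 (ltry _).
Qed.

Lemma mB_gt0 r : 0 < mB r.
Proof.
have [e _ /(_ r)] := ball_lower_bound; rewrite ballE lee_fin; apply: lt_le_trans.
by rewrite mulr_gt0 ?powR_gt0 // invr_gt0 exprn_gt0.
Qed.

Let rate r : R := - ln (mB r) / ln 2.

Let ln2_gt0 : 0 < ln 2 :> R. Proof. by apply: ln_gt0; rewrite ltr1n. Qed.

Lemma local_rateE r : (0 < r)%N -> local_rate mu x r = (rate r / r%:R)%:E.
Proof.
move=> r0; rewrite /local_rate /log2 -/(ball r) ballE inver gt_eqF ?mB_gt0 //.
rewrite lne_EFin ?invr_gt0 ?mB_gt0 // lnV ?posrE ?mB_gt0 //.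
by rewrite !inver !gt_eqF ?ltr0n // -!EFinM.
Qed.

Lemma rate_le_complexity :
  asymptotically_le rate (fun r => (complexity_at U x r)%:R).
Proof.
move=> d d0; have [e /eqoP eo lb] := ball_lower_bound; exists c.
have d2 : 0 < d / 2 by rewrite divr_gt0.
have /(near_addn _ c) {}eo := eo _ d2.
near=> r.
have er : `|e (r + c)%N| <= d / 2 * `|(r + c)%:R : R| by near: r.
(* Then r + c is at most 2 r, and d/2 times r + c is at most d r. *)
have rc : (c <= r)%N by near: r; exists c.
have K0 : 0 <= (complexity_at U x (r + c))%:R :> R by [].
have : rate r <= (complexity_at U x (r + c))%:R + e (r + c)%N.
  rewrite /rate ler_pdivrMr //; have := lb r; rewrite ballE lee_fin.
  rewrite -ler_ln ?posrE ?mB_gt0 ?mulr_gt0 ?powR_gt0 ?invr_gt0 ?exprn_gt0 //.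
  rewrite lnM ?posrE ?powR_gt0 ?invr_gt0 ?exprn_gt0 // ln_powR lnV ?posrE ?exprn_gt0 //.
  rewrite lnXn // -mulr_natl; lra.
have : e (r + c)%N <= d * r%:R.
  apply: le_trans (ler_norm _) (le_trans er _).
  rewrite ger0_norm // natrD; have : c%:R <= r%:R :> R by rewrite ler_nat.
  by nra.
by nra.
Unshelve. all: by end_near. Qed.

Lemma complexity_le_rate :
  asymptotically_le (fun r => (complexity_at U x r)%:R) rate.
Proof.
have [fmu lmu _] := hmu.
have [C HC] := complexity_cube hU fmu lmu.
have [c3 Hc3] := outer_measure_finite fmu lmu.
have rate_ge r : - c3%:R <= rate r.
  rewrite /rate ler_pdivlMr // mulNr lerN2.
  rewrite mulr_natl -lnXn // ler_ln ?posrE ?mB_gt0 ?exprn_gt0 //.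
  by rewrite -lee_fin -ballE; exact: Hc3.
(* By subadditivity one of the 3^n cubes that cover the ball has measure above 2^-k. *)
have bound r k : 2 ^- k < mB (r + c)%N / 3 ^+ n ->
    (complexity_at U x r <= size (nat_code (r + c)) + size (nat_code k) + k + C)%N.
  move=> ltk.
  have [d Hd] : exists d, ((2 ^- k)%:E < mu (dyadic_cube (r + c) (neighbour x (r + c) d)))%E.
    apply/not_existsP => Hd.
    have : (ball (r + c) <= (3 ^+ n * 2 ^- k)%:E)%E.
      apply: le_trans (le_outer_measure mu _ _ (@ball_cover _ _ x (r + c))) _.
      apply: le_trans (outer_measure_cover _ _ _) _.
      apply: (@le_trans _ _ (\sum_(d <- enum {ffun 'I_n -> 'I_3}) (2 ^- k)%:E)%E).
        by apply: lee_sum => d _; rewrite leNgt; apply/negP/Hd.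
      rewrite sumEFin lee_fin big_const_seq count_predT -cardE card_ffun !card_ord.
      by rewrite iter_addr_0 -[X in X <= _]mulr_natl natrX.
    rewrite ballE lee_fin leNgt => /negP; apply.
    by rewrite mulrC -ltr_pdivlMr ?exprn_gt0.
  have [q Hq qK] := HC _ _ _ Hd.
  by apply: leq_trans qK; exact: complexity_at_le (neighbour_dist nc Hq).
move=> d d0; exists c.
have d2 : 0 < d / 2 by rewrite divr_gt0.
have [C1 HC1] := size_nat_code_little d2.
(* 2 n dominates the logarithm of 3^n, and [c3] makes the rate plus w nonnegative, so that it can be
   rounded to a natural number. *)
pose w : R := (2 * n + c3)%:R.
(* All terms of the final estimate that do not depend on r; half of the slack d * r absorbs them,
   the other half the code of r + c. *)
pose K : R := 2 * C1 + C%:R + d / 2 * c%:R + (1 + d) * (w + 1).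
near=> r.
have hK : K <= d / 2 * r%:R by near: r; apply: near_linear.
have y0 : 0 <= rate (r + c)%N + w.
  have := rate_ge (r + c)%N; rewrite /w natrD.
  have : 0 <= (2 * n)%:R :> R by []. lra.
pose k := (Num.truncn (rate (r + c)%N + w)).+1.
have k1 : rate (r + c)%N + w < k%:R by rewrite /k; exact: truncnS_gt.
have k2 : k%:R <= rate (r + c)%N + w + 1.
  by rewrite /k -natr1 lerD2r truncn_le.
have /bound : 2 ^- k < mB (r + c)%N / 3 ^+ n.
  rewrite -ltr_ln ?posrE ?divr_gt0 ?invr_gt0 ?exprn_gt0 ?mB_gt0 //.
  rewrite lnV ?posrE ?exprn_gt0 // lnXn // lnM ?posrE ?invr_gt0 ?exprn_gt0 ?mB_gt0 //.
  rewrite lnV ?posrE ?exprn_gt0 // lnXn //.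
  have rE : ln (mB (r + c)%N) = - (rate (r + c)%N * ln 2) by rewrite /rate mulfVK ?gt_eqF // opprK.
  have l3 : ln 3 <= 2 * ln 2 :> R.
    by rewrite mulr_natl -lnXn // ler_ln ?posrE ?exprn_gt0 // -natrX ler_nat.
  rewrite rE -!(mulr_natl (ln _)).
  have : n%:R * ln 3 <= n%:R * (2 * ln 2) :> R by rewrite ler_wpM2l.
  have c30 : 0 <= c3%:R * ln 2 :> R by rewrite mulr_ge0 // ltW.
  by move: k1; rewrite -(ltr_pM2r ln2_gt0) /w natrD natrM => k1; lra.
rewrite -(ler_nat R) !natrD => H.
have h1 := HC1 (r + c)%N; have h2 := HC1 k; rewrite natrD in h1.
rewrite /K in hK.
have h3 : d / 2 * k%:R <= d * (rate (r + c)%N + w + 1).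
  apply: (@le_trans _ _ (d * k%:R)); last by rewrite ler_pM2l.
  by rewrite ler_wpM2r //; lra.
by lra.
Unshelve. all: by end_near. Qed.

Lemma dimensions_agree : dim_loc mu x = alg_dim U x /\ Dim_loc mu x = alg_Dim U x.
Proof.
have hr : \forall r \near \oo, local_rate mu x r = (rate r / r%:R)%:E.
  by exists 1%N => // r; exact: local_rateE.
have hc : \forall r \near \oo, ((complexity_at U x r)%:R / r%:R)%:E =
    ((complexity_at U x r)%:R / r%:R)%:E :> \bar R by exact: nearW.
split; apply/eqP; rewrite eq_le; apply/andP; split.
- exact: le_limn_einf rate_le_complexity hc hr.
- exact: le_limn_einf complexity_le_rate hr hc.
- exact: le_limn_esup rate_le_complexity hc hr.
- exact: le_limn_esup complexity_le_rate hr hc.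
Qed.

End Main.

Theorem theorem4p10 (R : realType) (n : nat) (hn : (1 <= n)%N)
    (U : machine) (hU : universal_prefix_machine U)
    (mu : {outer_measure set 'rV[R]_n -> \bar R}) (hmu : locally_optimal mu)
    (x : 'rV[R]_n) :
  dim_loc mu x = alg_dim U x /\ Dim_loc mu x = alg_Dim U x.
Proof. exact: dimensions_agree. Qed.
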